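(* There are two connected closed manifolds $M$ and $L$ of dimension $n\neq 3$, a closed $1$-form $\beta\in\Omega^1(M)$ and an embedding $i:L\rightarrow (T^*M,\lambda,\beta)$ such that $i(L)$ is a $\beta$-exact Lagrangian of $(T^*M,\lambda,\beta)$, where $\lambda$ is the canonical Liouville form on $T^*M$, and 1. $\chi(L)\neq\chi(M)$, where $\chi$ is the Euler characteristic, 2. or $L$ has no associated generating function, i.e. there is no generating function $F$ (in the locally conformally symplectic sense, with respect to $\beta$) such that $i(L)=L_F$.
   Context: For a closed $1$-form $\beta$ on a manifold, the Lichnerowicz derivative is $d_\beta\alpha=d\alpha-\beta\wedge\alpha$; in particular $d_\beta f=df-f\beta$ for a function $f$. Pullbacks of $\beta$ (to $T^*M$, to $M\times\mathbb{R}^k$, ...) are also denoted $\beta$. $(T^*M,\lambda,\beta)$ denotes $T^*M$ with the exact locally conformally symplectic structure $d_\beta\lambda$, with $\lambda$ the canonical Liouville form. An embedding $i:L\to T^*M$ with $\dim L=\dim M$ is $\beta$-exact Lagrangian if $i^*\lambda=d_{i^*\beta}f$ for some $f\in C^\infty(L)$; then $i(L)$ is called a $\beta$-exact Lagrangian (submanifold). Generating functions: for a smooth $F:N\to\mathbb{R}$ and a closed $1$-form $\beta$ on $N$, $\Gamma_\beta(F)=\{d_\beta F_{|x}:x\in N\}\subset T^*N$. For $k\in\mathbb{N}$, a smooth map $F:M\times\mathbb{R}^k\to\mathbb{R}$ is a generating function (with respect to $\beta$) if there is a compact $K\subset\mathbb{R}^k$ such that $F$ is quadratic outside of $M\times K$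 (''quadratic at infinity'') and $d_\beta F$ intersects $(T^*M)\times\mathbb{R}^k$ transversely in $T^*(M\times\mathbb{R}^k)$ (here $(T^*M)\times\mathbb{R}^k$ is the set of covectors vanishing on the $\mathbb{R}^k$ directions). In this case $V_F:=\Gamma_\beta(F)\cap\big((T^*M)\times\mathbb{R}^k\big)$, and the projection of $V_F$ to $T^*M$ is the (immersed) Lagrangian submanifold associated to $F$, denoted $L_F$. *)

(* Defs.v *)
From HB Require Import structures.
From mathcomp Require Import all_boot all_order all_algebra.
From mathcomp Require Import all_classical all_reals all_analysis.

Set Implicit Arguments.
Unset Strict Implicit.
Unset Printing Implicit Defensive.

Import Order.TTheory GRing.Theory Num.Theory.
Import numFieldNormedType.Exports.

Local Open Scope classical_set_scope.
Local Open Scope ring_scope.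

Definition basis_vec (R : realType) n (j : 'I_n) : 'rV[R]_n := delta_mx 0 j.

Definition pairing (R : realType) n (xi v : 'rV[R]_n) : R :=
  \sum_j xi 0 j * v 0 j.

(* Meaningful for an open set U. *)
Fixpoint Ck (R : realType) n (k : nat) (U : set 'rV[R]_n) (f : 'rV[R]_n -> R)
    : Prop :=
  (forall v, U v -> {for v, continuous f}) /\
  if k is k'.+1 then
    forall j : 'I_n, (forall v, U v -> derivable f v (basis_vec R j)) /\
      Ck k' U (fun v => 'D_(basis_vec R j) f v)
  else True.

Definition smooth_on (R : realType) n (U : set 'rV[R]_n) (f : 'rV[R]_n -> R) :=
  forall k, Ck k U f.

Definition smooth_on_rV (R : realType) n m (U : set 'rV[R]_n)
    (f : 'rV[R]_n -> 'rV[R]_m) :=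
  forall c : 'I_m, smooth_on U (fun v => f v 0 c).

(* A set with a family of n-dimensional charts, as raw data: the axioms of a
   smooth manifold are in [is_manifold].  [param a] is the inverse of [chart a]
   on the image of [chart_dom a], and arbitrary elsewhere.  The preferred chart
   [chart_at x] at x identifies the tangent space and the cotangent space at x
   with R^n. *)
Record charted (R : realType) (n : nat) := Charted {
  points :> Type;
  atlas : Type;
  chart_dom : atlas -> set points;
  chart : atlas -> points -> 'rV[R]_n;
  param : atlas -> 'rV[R]_n -> points;
  chart_at : points -> atlas
}.

Arguments chart_at {R n c}.

Section AtlasTopology.
Context (R : realType) (n : nat) (X : charted R n).

(* For a manifold: the image of W in every chart is open. *)
Definition atlas_open (W : set X) :=
  forall a x, chart_dom a x -> W x ->
    \forall v \near chart a x, W (param a v).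

Lemma atlas_openT : atlas_open setT.
Proof. by move=> a x _ _; exact: filterT. Qed.

Lemma atlas_openI : setI_closed atlas_open.
Proof.
move=> A B oA oB a x ax [Ax Bx].
by near=> v; split; near: v; [exact: oA|exact: oB].
Unshelve. all: by end_near. Qed.

Lemma atlas_open_bigU (I : Type) (f : I -> set X) :
  (forall i, atlas_open (f i)) -> atlas_open (\bigcup_i f i).
Proof.
move=> of_ a x ax [i _ fx].
by near=> v; exists i => //; near: v; exact: of_.
Unshelve. all: by end_near. Qed.

HB.instance Definition _ := gen_eqMixin (points X).
HB.instance Definition _ := gen_choiceMixin (points X).
HB.instance Definition _ :=
  isOpenTopological.Build (points X) atlas_openT atlas_openI atlas_open_bigU.

End AtlasTopology.

Definition is_manifold (R : realType) n (X : charted R n) :=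
  [/\ forall x : X, chart_dom (chart_at x) x,
      forall a (x : X), chart_dom a x -> param a (chart a x) = x,
      forall a b : atlas X,
        open (chart a @` (chart_dom a `&` chart_dom b)) /\
        smooth_on_rV (chart a @` (chart_dom a `&` chart_dom b))
          (chart b \o param a),
      hausdorff_space X &
      @second_countable X].

Definition connected_closed_manifold (R : realType) n (X : charted R n) :=
  [/\ is_manifold X, [set: X] !=set0, compact [set: X] & connected [set: X]].

Definition euclid (R : realType) (n : nat) : charted R n :=
  @Charted R n 'rV[R]_n unit (fun=> setT) (fun=> id) (fun=> id) (fun=> tt).

Definition prod_charted (R : realType) m n (X : charted R m) (Y : charted R n)
    : charted R (m + n) :=
  @Charted R (m + n) (X * Y)%type (atlas X * atlas Y)%type
    (fun a => chart_dom a.1 `*` chart_dom a.2)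
    (fun a z => row_mx (chart a.1 z.1) (chart a.2 z.2))
    (fun a v => (param a.1 (lsubmx v), param a.2 (rsubmx v)))
    (fun z => (chart_at z.1, chart_at z.2)).

Definition smooth_map (R : realType) m n (X : charted R m) (Y : charted R n)
    (f : X -> Y) :=
  continuous f /\
  forall a b, smooth_on_rV (chart a @` (chart_dom a `&` f @^-1` chart_dom b))
    (fun v => chart b (f (param a v))).

Definition smooth_fun (R : realType) n (X : charted R n) (f : X -> R) :=
  forall a, smooth_on (chart a @` chart_dom a) (f \o param a).

(* The tangent map T_x X -> T_(f x) Y, read in the preferred charts at x and
   f x. *)
Definition tangent_map (R : realType) m n (X : charted R m) (Y : charted R n)
    (f : X -> Y) (x : X) (w : 'rV[R]_m) : 'rV[R]_n :=
  'D_w (chart (chart_at (f x)) \o f \o param (chart_at x))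
    (chart (chart_at x) x).

Definition embedding (R : realType) m n (X : charted R m) (Y : charted R n)
    (f : X -> Y) :=
  [/\ smooth_map f,
      forall x, injective (tangent_map f x),
      injective f &
      forall U : set X, open U -> exists2 V : set Y, open V & U = f @^-1` V].

(* For a submanifold W: the vectors of T_y Y tangent to W, as velocities at
   time 0 of smooth curves in W. *)
Definition tangent_to (R : realType) n (Y : charted R n) (W : set Y) (y : Y)
    : set 'rV[R]_n :=
  [set w | exists c : euclid R 1 -> Y,
     [/\ smooth_map c, c 0 = y, forall t, W (c t) &
         w = tangent_map c 0 (const_mx 1)]].

Definition transverse (R : realType) m n (X : charted R m) (Y : charted R n)
    (f : X -> Y) (W : set Y) :=
  forall x, W (f x) -> forall u : 'rV[R]_n,
    exists v w, tangent_to W (f x) w /\ u = tangent_map f x v + w.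

(* The components in the chart b of the covector at x with components xi in the
   chart a. *)
Definition change_covector (R : realType) n (X : charted R n) (a b : atlas X)
    (x : X) (xi : 'rV[R]_n) : 'rV[R]_n :=
  \row_j pairing xi ('D_(basis_vec R j) (chart a \o param b) (chart b x)).

(* (x, xi) is the covector at x with components xi in the preferred chart at
   x. *)
Definition cotangent (R : realType) n (X : charted R n) : charted R (n + n) :=
  @Charted R (n + n) (X * 'rV[R]_n)%type (atlas X)
    (fun a => [set p | chart_dom a p.1])
    (fun a p =>
       row_mx (chart a p.1) (change_covector (chart_at p.1) a p.1 p.2))
    (fun a v =>
       let x := param a (lsubmx v) in
       (x, change_covector a (chart_at x) x (rsubmx v)))
    (fun p => chart_at p.1).

Definition form1 (R : realType) n (X : charted R n) := X -> 'rV[R]_n.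

Definition section1 (R : realType) n (X : charted R n) (alpha : form1 X)
    : X -> cotangent X :=
  fun x => (x, alpha x).

Definition form1_coord (R : realType) n (X : charted R n) (alpha : form1 X)
    (a : atlas X) (j : 'I_n) (v : 'rV[R]_n) : R :=
  let x := param a v in change_covector (chart_at x) a x (alpha x) 0 j.

Definition closed_form1 (R : realType) n (X : charted R n) (alpha : form1 X) :=
  smooth_map (section1 alpha) /\
  forall a j k v, (chart a @` chart_dom a) v ->
    'D_(basis_vec R j) (form1_coord alpha a k) v =
    'D_(basis_vec R k) (form1_coord alpha a j) v.

Definition pullback (R : realType) m n (X : charted R m) (Y : charted R n)
    (f : X -> Y) (alpha : form1 Y) : form1 X :=
  fun x => \row_j pairing (alpha (f x)) (tangent_map f x (basis_vec R j)).

Definition differential (R : realType) n (X : charted R n) (f : X -> R)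
    : form1 X :=
  fun x => \row_j
    'D_(basis_vec R j) (f \o param (chart_at x)) (chart (chart_at x) x).

Definition lichnerowicz (R : realType) n (X : charted R n) (beta : form1 X)
    (f : X -> R) : form1 X :=
  fun x => differential f x - f x *: beta x.

Definition cotangent_proj (R : realType) n (X : charted R n)
    : cotangent X -> X := fst.

Definition liouville (R : realType) n (X : charted R n)
    : form1 (cotangent X) :=
  fun p => \row_j pairing p.2
    (tangent_map (@cotangent_proj R n X) p (basis_vec R j)).

Definition exact_lagrangian (R : realType) n (M L : charted R n)
    (beta : form1 M) (i : L -> cotangent M) :=
  embedding i /\
  exists2 f : L -> R, smooth_fun f &
    pullback i (liouville (X:=M)) =
    lichnerowicz (pullback i (pullback (@cotangent_proj R n M) beta)) f.

Section GeneratingFunctions.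
Context (R : realType) (n k : nat) (M : charted R n) (beta : form1 M).

Let MRk := prod_charted M (euclid R k).

Definition base_proj : MRk -> M := fst.

Definition d_beta (F : MRk -> R) : form1 MRk :=
  lichnerowicz (pullback base_proj beta) F.

Definition Gamma (F : MRk -> R) : set (cotangent MRk) :=
  range (section1 (d_beta F)).

(* (T^*M) x R^k: the covectors vanishing on the R^k directions. *)
Definition horizontal : set (cotangent MRk) :=
  [set p | forall w, tangent_map base_proj p.1 w = 0 -> pairing p.2 w = 0].

(* F(x, .) is given by a quadratic form outside of K, possibly depending on
   x. *)
Definition quadratic_at_infinity (F : MRk -> R) :=
  exists2 K : set 'rV[R]_k, compact K &
    forall x : M, exists A : 'M[R]_k, forall v : 'rV[R]_k, ~ K v ->
      F (x, v) = (v *m A *m v^T) 0 0.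

Definition generating_function (F : MRk -> R) :=
  [/\ smooth_fun F, quadratic_at_infinity F &
      transverse (section1 (d_beta F)) horizontal].

Definition V_ (F : MRk -> R) : set (cotangent MRk) := Gamma F `&` horizontal.

(* The projection (T^*M) x R^k -> T^*M sends the covector zeta at z to the
   covector xi at [base_proj z] such that zeta = xi o d(base_proj). *)
Definition generated_lagrangian (F : MRk -> R) : set (cotangent M) :=
  [set q | exists2 p, V_ F p &
     q.1 = base_proj p.1 /\
     forall w, pairing p.2 w = pairing q.2 (tangent_map base_proj p.1 w)].

End GeneratingFunctions.

Definition simplex (R : realType) (k : nat) : set 'rV[R]_k.+1 :=
  [set v | (forall j, 0 <= v 0 j) /\ \sum_j v 0 j = 1].

Definition insert0 (R : realType) k (i : 'I_k.+2) (v : 'rV[R]_k.+1)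
    : 'rV[R]_k.+2 :=
  \row_j (if unlift i j is Some j' then v 0 j' else 0).

Lemma insert0_simplex (R : realType) k (i : 'I_k.+2) (v : 'rV[R]_k.+1) :
  simplex v -> simplex (insert0 i v).
Proof.
move=> [v0 v1]; split=> [j|]; first by rewrite mxE; case: unlift.
rewrite (bigD1_ord i) //= mxE unlift_none add0r -[RHS]v1.
by apply: eq_bigr => j _; rewrite mxE liftK.
Qed.

Definition face (R : realType) k (i : 'I_k.+2) (v : simplex (R:=R) (k:=k))
    : simplex (R:=R) (k:=k.+1) :=
  SigSub (mem_set (insert0_simplex i (set_mem (valP v)))).

Section SingularHomology.
Context (R : realType) (T : topologicalType).

Definition singular (k : nat) := continuousType (simplex (R:=R) (k:=k)) T.

(* Rational formal sums of singular simplices, as functions with finite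
   support. *)
Definition is_chain k (c : singular k -> rat) := finite_set [set s | c s != 0].

(* The coefficient at t is the sum of (-1)^i c(s) over the pairs (i, s) such
   that t is the i-th face of s. *)
Definition boundary k (c : singular k.+1 -> rat) : singular k -> rat :=
  fun t => \sum_(i < k.+2) (-1) ^+ i *
    \sum_(s \in [set s : singular k.+1 | s \o face i = t :> (_ -> _)]) c s.

Definition is_cycle k : (singular k -> rat) -> Prop :=
  if k is k'.+1 then fun c => is_chain c /\ boundary c = fun=> 0
  else @is_chain 0.

Definition is_boundary k (c : singular k -> rat) :=
  exists2 b : singular k.+1 -> rat, is_chain b & boundary b = c.

(* There are d linearly independent classes in H_k(T; Q). *)
Definition independent_classes (k d : nat) :=
  exists2 z : 'I_d -> singular k -> rat, forall i, is_cycle (z i) &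
    forall a : 'I_d -> rat,
      is_boundary (fun s => \sum_i a i * z i s) -> forall i, a i = 0.

(* The dimension of H_k(T; Q) (0 if it is infinite). *)
Definition betti (k : nat) : nat :=
  xget 0%N [set d | independent_classes k d /\ ~ independent_classes k d.+1].

(* A sum with finite support for a closed manifold. *)
Definition euler_char : int :=
  \sum_(k \in [set: nat]) (-1) ^+ k * (betti k)%:Z.

End SingularHomology.

(* Main.v *)
Require Import Defs.
From mathcomp Require Import all_boot all_order all_algebra.
From mathcomp Require Import all_classical all_reals all_analysis.
From mathcomp Require Import ring lra.

(* The example is M = L = T^2 = R^2/(2 pi Z)^2 with beta = dx_0.  Since
   p_0 dx_0 + p_1 dx_1 + d_beta p_0 = dp_0 + p_1 dx_1, the product of the circle
   with a Legendrian curve of the contact form dp_0 + p_1 dx_1 on {(x_1, p_0, p_1)}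
   is beta-exact, with primitive - p_0.  The Legendrian unknot
   (x_1, p_0, p_1) = (cos t, sin^3 t, 3 sin t cos t) gives a torus whose projection
   to M misses the circle x_1 = pi.

   On the other hand L_F projects onto M for every generating function F: over
   each x, the function F(x, .) on R^k has a critical point.  Outside of a compact
   set its differential is a linear map B.  If B is singular, its kernel contains
   points outside of the compact set; otherwise dF(x, .) B^-1 is the identity
   outside of a compact set and has a zero by the Poincare-Miranda theorem. *)

Set Implicit Arguments.
Unset Strict Implicit.
Unset Printing Implicit Defensive.

Import Order.TTheory GRing.Theory Num.Theory.
Import numFieldNormedType.Exports.

Local Open Scope classical_set_scope.
Local Open Scope ring_scope.

(** * The Poincare-Miranda theorem *)

Section GridForms.
Context (k : nat).

Local Notation grid := {ffun 'I_k -> nat}.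
(* Cubical cochains mod 2: for w : gform, w S z is the value of w on the unit cube
   with lowest corner z and edges in the directions in S. *)
Local Notation gform := ({set 'I_k} -> grid -> 'F_2).

Definition upd (z : grid) (i : 'I_k) (t : nat) : grid :=
  [ffun l => if l == i then t else z l].

Definition shift (i : 'I_k) (z : grid) : grid := upd z i (z i).+1.

Lemma shift_upd i z t : shift i (upd z i t) = upd z i t.+1.
Proof. by apply/ffunP => l; rewrite !ffunE eqxx; case: eqP. Qed.

Lemma updC i j z s t : i != j -> upd (upd z i s) j t = upd (upd z j t) i s.
Proof.
move=> nij; apply/ffunP => l; rewrite !ffunE.
by case: (eqVneq l i) => // ->; rewrite (negPf nij).
Qed.

Lemma shift_updC i j z t : i != j -> shift i (upd z j t) = upd (shift i z) j t.
Proof. by move=> nij; rewrite /shift ffunE (negPf nij) updC // eq_sym. Qed.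

Lemma shiftC i j z : shift i (shift j z) = shift j (shift i z).
Proof.
have [->//|ij] := eqVneq i j.
by rewrite [shift j z]/shift shift_updC // {2}/shift ffunE eq_sym (negPf ij).
Qed.

(** The cubical coboundary; with coefficients in F_2 it needs no alternating signs. *)
Definition gdiff (w : gform) : gform := fun S z =>
  \sum_(i in S) (w (S :\ i) (shift i z) - w (S :\ i) z).

(** The terms at (i, j) and (j, i) cancel in characteristic 2. With the symmetry of mixed second
    differences this gives d o d = 0. *)
Lemma sum_sym_eq0 (S : {set 'I_k}) (T : 'I_k -> 'I_k -> 'F_2) :
  (forall i j, T i j = T j i) -> \sum_(i in S) \sum_(j in S :\ i) T i j = 0.
Proof.
move=> Tsym.
have -> : \sum_(i in S) \sum_(j in S :\ i) T i j =
    \sum_(i in S) \sum_(j in S | (j < i)%N) T i j +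
    \sum_(i in S) \sum_(j in S | (i < j)%N) T i j.
  rewrite -big_split /=; apply: eq_bigr => i iS.
  rewrite (bigID (fun j : 'I_k => (j < i)%N)) /=; congr (_ + _);
    apply: eq_bigl => j; rewrite !inE -val_eqE /=;
    by case: ltngtP; rewrite ?andbT ?andbF.
rewrite [X in _ + X](exchange_big_dep (fun j => j \in S)) /=; last first.
  by move=> ? ? _ /andP[].
rewrite -big_split big1 //= => i iS.
rewrite [X in _ + X](_ : _ = \sum_(j in S | (j < i)%N) T i j).
  exact: addrr_pchar2.
by apply: eq_big => [j|j _]; rewrite ?iS.
Qed.

Lemma gdiffK w S z : gdiff (gdiff w) S z = 0.
Proof.
rewrite /gdiff.
under eq_bigr do rewrite -sumrB.
apply: sum_sym_eq0 => i j.
have -> : S :\ i :\ j = S :\ j :\ i.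
  by apply/setP => l; rewrite !inE andbCA.
rewrite (shiftC j i); ring.
Qed.

(* The cup product of the coboundaries of the 0-cochains f_j, j in s. *)
Fixpoint cup (f : 'I_k -> grid -> 'F_2) (s : seq 'I_k) : gform :=
  if s is j :: s' then gdiff (fun S z => f j z * cup f s' S z)
  else fun S _ => (S == finset.set0)%:R.

Variable f : 'I_k -> grid -> 'F_2.

Lemma cup_closed s S z : gdiff (cup f s) S z = 0.
Proof.
case: s => [|j s] /=; last exact: gdiffK.
by rewrite /gdiff big1 // => i _; rewrite subrr.
Qed.

(** Leibniz rule: subtracting the vanishing [f j z * gdiff (cup f s) S z] from the coboundary of the
    product leaves only the jumps of [f j]. *)
Lemma cup_cons j s S z : cup f (j :: s) S z =
  \sum_(i in S) (f j (shift i z) - f j z) * cup f s (S :\ i) (shift i z).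
Proof.
have := congr1 ( *%R (f j z)) (cup_closed s S z).
rewrite mulr0 /= /gdiff mulr_sumr => fd0.
apply/eqP; rewrite -subr_eq0 -sumrB; apply/eqP; rewrite -[RHS]fd0.
by apply: eq_bigr => i _ /=; ring.
Qed.

(** A nonzero product has a nonzero term in [cup_cons]: the first factor jumps along an edge at [z],
    and the product of the others is nonzero on the opposite face, of directions [S :\ i] and corner
    [shift i z]. So every factor jumps along some edge of the cube. *)
Lemma cup_neq0 s S z : cup f s S z != 0 -> forall j, j \in s ->
  exists i (w : grid), [/\ i \in S, w i = z i,
    forall l, (z l <= w l <= z l + (l \in S))%N & f j (shift i w) != f j w].
Proof.
elim: s S z => // j s IHs S z; rewrite cup_cons => /eqP sum_neq0 h.
have [i /andP[iS]] : exists i, (i \in S) &&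
    ((f j (shift i z) - f j z) * cup f s (S :\ i) (shift i z) != 0).
  apply/existsP; apply: contra_notT sum_neq0 => /existsPn nex.
  by apply: big1 => i iS; move: (nex i); rewrite iS /= negbK => /eqP.
rewrite mulf_eq0 negb_or subr_eq0 => /andP[fj /IHs{}IHs].
rewrite inE => /predU1P[->|/IHs[l [w [lS wl wz fh]]]].
  by exists i, z; split=> // l; rewrite leqnn leq_addr.
move: lS; rewrite !inE => /andP[li lS].
have := wl; rewrite ffunE (negPf li) => wl'.
exists l, w; split=> // m; have := wz m; rewrite !ffunE !inE.
by case: eqP => [->|//]; rewrite iS addn0 addn1 => /andP[/ltnW -> ->].
Qed.

(** * Integration of cochains over a box of side N in the directions of a list *)

Fixpoint boxsum (N : nat) (s : seq 'I_k) (g : grid -> 'F_2) (z : grid) : 'F_2 :=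
  if s is i :: s' then \sum_(t < N) boxsum N s' g (upd z i t) else g z.

Variable N : nat.

Lemma boxsum_ext s g h (z : grid) :
  (forall w : grid, (forall l, l \notin s -> w l = z l) ->
             (forall l, l \in s -> (w l < N)%N) -> g w = h w) ->
  boxsum N s g z = boxsum N s h z.
Proof.
elim: s z => [|i s IHs] z gh /=; first exact: gh.
apply: eq_bigr => t _; apply: IHs => w wz wN; apply: gh => l.
  by rewrite inE negb_or => /andP[li /wz]; rewrite ffunE (negPf li).
rewrite inE; have [ls _|ls] := boolP (l \in s); first exact: wN.
by rewrite orbF => /eqP li; rewrite wz // ffunE li eqxx.
Qed.

Lemma boxsum0 s z : boxsum N s (fun=> 0) z = 0.
Proof. by elim: s z => //= i s IHs z; apply: big1. Qed.

Lemma boxsumB s g h z :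
  boxsum N s (fun w => g w - h w) z = boxsum N s g z - boxsum N s h z.
Proof. by elim: s z => //= i s IHs z; rewrite -sumrB; exact: eq_bigr. Qed.

Lemma boxsum_sum (I : finType) (P : pred I) s (g : I -> grid -> 'F_2) z :
  boxsum N s (fun w => \sum_(i | P i) g i w) z =
  \sum_(i | P i) boxsum N s (g i) z.
Proof.
by elim: s z => //= i s IHs z; rewrite exchange_big; exact: eq_bigr.
Qed.

Lemma boxsum_shift i s g z : i \notin s ->
  boxsum N s (g \o shift i) z = boxsum N s g (shift i z).
Proof.
elim: s z => //= j s IHs z; rewrite inE negb_or => /andP[ij /IHs {}IHs].
by apply: eq_bigr => t _; rewrite IHs shift_updC.
Qed.

(** The sum in the direction [i] telescopes. *)
Lemma boxsum_diff i s g z : i \notin s ->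
  boxsum N (i :: s) (fun w => g (shift i w) - g w) z =
  boxsum N s g (upd z i N) - boxsum N s g (upd z i 0).
Proof.
move=> iNs /=.
rewrite -(telescope_sumr (fun t => boxsum N s g (upd z i t))) // big_mkord.
by apply: eq_bigr => t _; rewrite boxsumB (boxsum_shift _ _ iNs) shift_upd.
Qed.

Lemma boxsum_eq0 s g (z : grid) :
  (forall w : grid, (forall l, l \notin s -> w l = z l) -> g w = 0) ->
  boxsum N s g z = 0.
Proof.
by move=> g0; rewrite -(boxsum0 s z); apply: boxsum_ext => w wz _; exact: g0.
Qed.

(** Telescoping leaves the two faces orthogonal to [i], where [g] vanishes. As [i] may be an inner
    summation direction, the induction descends along [s] to reach it. *)
Lemma boxsum_diff0 i s g z : uniq s -> i \in s ->
  (forall w : grid, w i = 0%N \/ w i = N -> g w = 0) ->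
  boxsum N s (fun w => g (shift i w) - g w) z = 0.
Proof.
move=> + + g0; elim: s z => //= j s IHs z /andP[jNs us].
rewrite inE; have [ij _|ij /= is_] := eqVneq i j; last first.
  by apply: big1 => t _; exact: IHs.
rewrite -ij in jNs *.
rewrite -/(boxsum N (i :: s) _ z) boxsum_diff //.
rewrite !boxsum_eq0 ?subrr // => w /(_ i jNs); rewrite ffunE eqxx => wi;
  by apply: g0; auto.
Qed.

(* Discrete Stokes: as f_i is constant on the faces w_i = 0 and w_i = N, only the
   jump of f_j between the two faces orthogonal to j contributes. *)
Lemma boxsum_cup s z : uniq s ->
  (forall j (w : grid), j \in s -> w j = 0%N -> f j w = 0) ->
  (forall j (w : grid), j \in s -> w j = N -> f j w = 1) ->
  boxsum N s (cup f s [set j in s]%SET) z = 1.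
Proof.
elim: s z => [|j s IHs] z /=; first by rewrite eqxx.
move=> /andP[jNs us] f0 f1.
set S := [set _ in _]%SET.
pose g i w := f j w * cup f s (S :\ i) w.
rewrite -/(boxsum N (j :: s) _ z).
rewrite [LHS](boxsum_sum (mem S) (j :: s) (fun i w => g i (shift i w) - g i w)).
have Sj : S :\ j = [set i in s]%SET.
  by apply/setP => l; rewrite !inE; case: eqVneq => // ->; rewrite (negPf jNs).
rewrite (bigD1 j) ?inE ?eqxx //= [X in _ + X]big1 ?addr0; last first.
  move=> i /andP[]; rewrite !inE => /predU1P[->|is_ ij]; first by rewrite eqxx.
  rewrite -/(boxsum N (j :: s) _ z) boxsum_diff0 //= ?jNs ?inE ?is_ ?orbT //.
  move=> w wi; rewrite /g; apply/eqP; rewrite mulf_eq0 orbC.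
  (* Otherwise [f i] would jump along an edge of a cube without the direction [i]; this cube lies in
     a face w_i = 0 or w_i = N, where [f i] is constant. *)
  apply: contraT; rewrite negb_or => /andP[/cup_neq0 /(_ i is_)].
  move=> [l [y [+ _ yw fi]]] _; have := yw i; rewrite !inE eqxx addn0.
  rewrite -eqn_leq => /eqP wy /andP[li _]; rewrite eq_sym in li.
  move: fi; case: wi => wi.
    by rewrite !f0 ?inE ?is_ ?orbT ?ffunE ?(negPf li) -?wy ?eqxx.
  by rewrite !f1 ?inE ?is_ ?orbT ?ffunE ?(negPf li) -?wy ?eqxx.
rewrite -/(boxsum N (j :: s) _ z) boxsum_diff // [X in _ - X]boxsum_eq0; last first.
  by move=> w wz; rewrite /g f0 ?mul0r ?inE ?eqxx // wz // ffunE eqxx.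
rewrite subr0 -[RHS](IHs (upd z j N)) //; first last.
- by move=> i w is_; apply: f1; rewrite inE is_ orbT.
- by move=> i w is_; apply: f0; rewrite inE is_ orbT.
apply: boxsum_ext => w wz _.
by rewrite /g Sj f1 ?mul1r ?inE ?eqxx // wz // ffunE eqxx.
Qed.

End GridForms.

(** A discrete Poincare-Miranda theorem: the cup product of the coboundaries of all f_j has integral
    1 over the grid, so it is nonzero on some cube, and there each f_j takes both values. *)
Lemma grid_jumps k (N : nat) (f : 'I_k -> {ffun 'I_k -> nat} -> bool) :
  (forall j (w : {ffun _ -> _}), w j = 0%N -> f j w = false) ->
  (forall j (w : {ffun _ -> _}), w j = N -> f j w = true) ->
  exists z : {ffun 'I_k -> nat}, (forall l, (z l < N)%N) /\
    forall j, exists x y, [/\ f j x, ~~ f j y &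
      forall l, (z l <= x l <= (z l).+1)%N /\ (z l <= y l <= (z l).+1)%N].
Proof.
move=> f0 f1.
pose g j w : 'F_2 := (f j w)%:R.
have := @boxsum_cup k g N (enum 'I_k) [ffun=> 0%N] (enum_uniq _).
have -> : [set j in enum 'I_k]%SET = finset.setT.
  by apply/setP => l; rewrite !inE mem_enum.
move=> h; have {h}sum1 :
    boxsum N (enum 'I_k) (cup g (enum 'I_k) finset.setT) [ffun=> 0%N] = 1.
  by apply: h => j w _ wj; rewrite /g ?(f0 _ _ wj) ?(f1 _ _ wj).
have [z [zN cz]] : exists z : {ffun 'I_k -> nat}, (forall l, (z l < N)%N) /\
    cup g (enum 'I_k) finset.setT z != 0.
  apply: contrapT => nz; move: sum1; rewrite (boxsum_ext (h := fun=> 0)) ?boxsum0.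
    by move/eqP; rewrite eq_sym oner_eq0.
  move=> w _ wN; apply: contrapT => /eqP cw; apply: nz; exists w; split=> // l.
  by apply: wN; rewrite mem_enum.
exists z; split=> // j.
have [|i [w [_ wi zw]]] := cup_neq0 cz (j := j); first by rewrite mem_enum.
have {}zw l : (z l <= w l <= (z l).+1)%N by have := zw l; rewrite inE addn1.
have zsw l : (z l <= shift i w l <= (z l).+1)%N.
  by rewrite ffunE; case: eqP => [->|_ //]; rewrite wi leqnn leqnSn.
rewrite /g; case fs: (f j (shift i w)); case fw: (f j w); rewrite ?eqxx // => _.
  by exists (shift i w), w; rewrite fs fw.
by exists w, (shift i w); rewrite fs fw.
Qed.

(** On the grid of mesh 2r/(n+1), [grid_jumps] for the conditions phi_j > 0 gives a cube where each
    phi_j has a positive and a nonpositive value. By continuity every phi_j vanishes at a cluster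
    point of these cubes. *)
Lemma poincare_miranda (R : realType) k (r : R) (phi : 'I_k -> 'rV[R]_k -> R) :
  0 < r -> (forall j, continuous (phi j)) ->
  (forall j (v : 'rV[R]_k), v 0 j = r -> 0 < phi j v) ->
  (forall j (v : 'rV[R]_k), v 0 j = - r -> phi j v < 0) ->
  exists v, forall j, phi j v = 0.
Proof.
move=> r0 cphi phi_gt0 phi_lt0.
pose x n (z : {ffun 'I_k -> nat}) : 'rV[R]_k :=
  \row_l (- r + (z l)%:R * (r *+ 2 / n.+1%:R)).
have jumps n : exists z : {ffun 'I_k -> nat}, (forall l, (z l < n.+1)%N) /\
    forall j, exists a b, [/\ 0 < phi j a, phi j b <= 0,
      `|x n z - a| <= r *+ 2 / n.+1%:R & `|x n z - b| <= r *+ 2 / n.+1%:R].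
  have [||z [zn zj]] := @grid_jumps k n.+1 (fun j z => 0 < phi j (x n z)).
  - move=> j w wj; apply/negbTE; rewrite -leNgt ltW // phi_lt0 // mxE wj.
    by rewrite mul0r addr0.
  - move=> j w wj; rewrite phi_gt0 // mxE wj mulrC divfK //.
    by rewrite mulr2n addrA addNr add0r.
  have dx (w : {ffun 'I_k -> nat}) : (forall l, (z l <= w l <= (z l).+1)%N) ->
      `|x n z - x n w| <= r *+ 2 / n.+1%:R.
    move=> zw; have e0 : 0 <= r *+ 2 / n.+1%:R.
      by rewrite divr_ge0 // mulrn_wge0 // ltW.
    rewrite [leLHS]/Num.Def.normr /= mx_normrE.
    apply/bigmax_leP; split=> // -[i l] _ /=.
    rewrite !mxE opprD addrACA subrr add0r -mulrBl normrM (ger0_norm e0).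
    rewrite ler_piMl // distrC.
    have /andP[zw1 zw2] := zw l.
    by rewrite -natrB // normr_nat (ler_nat _ _ 1) leq_subLR addn1.
  exists z; split=> // j; have [a [b [fa fb ab]]] := zj j.
  exists (x n a), (x n b); rewrite leNgt fb; split=> //; apply: dx => l;
    by have [] := ab l.
have [z zP] := choice jumps.
have box_compact :=
  @rV_compact _ k (fun=> `[- r, r]%classic) (fun=> @segment_compact _ _ _).
have [|p [_ pP]] := box_compact ((fun n => x n (z n)) @ \oo)
  (fmap_proper_filter _ _).
  exists 0%N => // n _ l; rewrite /= in_itv /= mxE.
  have [/(_ l) zl _] := zP n.
  have e0 : 0 <= r *+ 2 / n.+1%:R by rewrite divr_ge0 // mulrn_wge0 // ltW.
  rewrite lerDl mulr_ge0 //= -lerBrDl opprK -mulr2n.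
  rewrite [leRHS](_ : _ = n.+1%:R * (r *+ 2 / n.+1%:R)); last first.
    by rewrite mulrC divfK.
  by rewrite ler_wpM2r // ler_nat ltnW.
have mesh0 (e : R) : 0 < e -> \forall n \near \oo, r *+ 2 / n.+1%:R < e.
  move=> e0; near=> n; rewrite ltr_pdivrMr // mulrC -ltr_pdivrMr //.
  apply: (@lt_trans _ _ n%:R); last by rewrite ltr_nat.
  by near: n; exact: nbhs_infty_gtr.
(* Eventually the mesh is below [e / 2], so [p] is also approached along such indices; two halves
   then place the vertices [a] and [b] within [e] of [p]. *)
have clusterP (e : R) : 0 < e -> exists n, r *+ 2 / n.+1%:R < e / 2 /\
    `|p - x n (z n)| < e / 2.
  move=> e0.
  have := pP [set x n (z n) | n in [set n | r *+ 2 / n.+1%:R < e / 2]]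
    (ball p (e / 2)).
  case.
  - have e2 : 0 < e / 2 by exact: divr_gt0.
    by have [m mP mesh] := mesh0 _ e2; exists m => // n /mesh ne; exists n.
  - by apply: nbhsx_ballx; exact: divr_gt0.
  - move=> _ [[n nP <-]]; rewrite -ball_normE /= => pn; by exists n.
exists p => j; apply/eqP; rewrite eq_le; apply/andP; split.
  rewrite leNgt; apply/negP => pj.
  have : \forall v \near p, 0 < phi j v by exact: (cvgr_gt _ (cphi j p)).
  move=> /nbhs_ballP[e /= e0]; rewrite -ball_normE /= => eP.
  have [n [ne pn]] := clusterP _ e0.
  have [_ /(_ j)[a [b [_ fb _ nb]]]] := zP n.
  suff : 0 < phi j b by rewrite ltNge fb.
  apply: eP => /=; rewrite -(subrKA (x n (z n))) (le_lt_trans (ler_normD _ _)) //.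
  by rewrite [e]splitr ltrD // (le_lt_trans nb).
rewrite leNgt; apply/negP => pj.
have : \forall v \near p, phi j v < 0 by exact: (cvgr_lt _ (cphi j p)).
move=> /nbhs_ballP[e /= e0]; rewrite -ball_normE /= => eP.
have [n [ne pn]] := clusterP _ e0.
have [_ /(_ j)[a [b [fa _ na _]]]] := zP n.
suff : phi j a < 0 by rewrite ltNge (ltW fa).
apply: eP => /=; rewrite -(subrKA (x n (z n))) (le_lt_trans (ler_normD _ _)) //.
by rewrite [e]splitr ltrD // (le_lt_trans na).
Unshelve. all: by end_near. Qed.

(** * Fibre critical points of functions quadratic at infinity *)

(** Reduces directional derivatives to derivatives in one variable, where explicit formulas can be
    differentiated. *)
Lemma is_derive_line (R : numFieldType) (V W : normedModType R) (f : V -> W)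
    (v w : V) (d : W) :
  is_derive (0 : R) (1 : R) (fun h : R => f (h *: w + v)) d <->
  is_derive v w f d.
Proof.
have dE : 'D_w f v = 'D_(1 : R) (fun h : R => f (h *: w + v)) 0.
  rewrite /derive; set g1 := fun h => h^-1 *: _; set g2 := fun h => h^-1 *: _.
  suff -> : g1 = g2 by [].
  apply/funext => h; rewrite /g1 /g2 /=.
  by rewrite addr0 scale0r add0r [_%:A]mulr1.
by split=> -[df <-]; split; rewrite ?dE //; exact/(derivable1P f v w).
Qed.

Lemma continuous_rV (R : realFieldType) (T : topologicalType) m
    (f : T -> 'rV[R]_m) (x : T) :
  (forall j, {for x, continuous (fun y => f y 0 j)}) -> {for x, continuous f}.
Proof.
move=> cf; apply/cvgrPdist_le => e e0; near=> y.
rewrite /Num.Def.normr /= mx_normrE (bigmax_le _ (ltW e0)) //= => -[i j] _.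
rewrite !mxE /= !ord1; move: j {i}; near: y; apply: filter_forall => j.
exact: (cvgrPdist_le _ _).1 (cf j) e e0.
Unshelve. all: by end_near. Qed.

Lemma continuous_row_mx (R : realFieldType) (T : topologicalType) m n
    (f : T -> 'rV[R]_m) (g : T -> 'rV[R]_n) (x : T) :
  {for x, continuous f} -> {for x, continuous g} ->
  {for x, continuous (fun y => row_mx (f y) (g y))}.
Proof.
move=> cf cg; apply: continuous_rV => j.
rewrite (_ : (fun _ => _) = fun y =>
  match fintype.split j with inl i => f y 0 i | inr i => g y 0 i end).
  case: (fintype.split j) => i.
    exact: (continuous_comp cf (@coord_continuous R 1 m 0 i (f x))).
  exact: (continuous_comp cg (@coord_continuous R 1 n 0 i (g x))).
by apply/funext => y; rewrite mxE; case: fintype.split.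
Qed.

(** The difference quotient of the affine map is constantly [l w]. The lemma serves projections and
    changes of charts, which are affine near the point. *)
Lemma is_derive_near_affine (R : numFieldType) (V W : normedModType R)
    (f : V -> W) (l : {linear V -> W}) (b : W) (v w : V) :
  (\forall u \near v, f u = l u + b) -> is_derive v w f (l w).
Proof.
move=> fE; apply: (near_eq_is_derive (f := fun u => l u + b)).
  by near do apply/esym.
have lim_w : (fun h => h^-1 *: (((fun u => l u + b) \o +%R^~ v) (h *: w)
    - (l v + b))) @ 0^' --> l w.
  apply: (@cvg_trans _ (cst (l w) @ (0 : R)^')); last exact: cvg_cst.
  apply: near_eq_cvg; near=> h => /=.
  rewrite opprD addrACA subrr addr0 -linearB addrK linearZ scalerA mulVf ?scale1r //.
  by near: h; exact: nbhs_dnbhs_neq.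
split; first by apply/cvg_ex; exists (l w).
exact: cvg_lim.
Unshelve. all: by end_near. Qed.

(** Along a line the form is a polynomial of degree at most 2 in [h]; its linear coefficient
    involves [A + A^T] since [A] may be non-symmetric. *)
Lemma is_derive_quadratic_form (R : realType) k (A : 'M[R]_k) (v w : 'rV[R]_k) :
  is_derive v w (fun u => (u *m A *m u^T) 0 0) ((v *m (A + A^T) *m w^T) 0 0).
Proof.
apply/is_derive_line.
pose q x y := (x *m A *m y^T : 'M[R]_1) 0 0.
rewrite (_ : (fun _ => _) =
    (fun h => q v v + (q v w + q w v) * h + q w w * h ^+ 2)); last first.
  apply/funext => h.
  rewrite /q [(_ + _)^T]raddfD /= [(_ *: _)^T]linearZ /= !(mulmxDl, mulmxDr).
  have addE (X Y : 'M[R]_1) : (X + Y) 0 0 = X 0 0 + Y 0 0 by rewrite mxE.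
  have scaleE c (X : 'M[R]_1) : (c *: X) 0 0 = c * X 0 0 by rewrite mxE.
  by rewrite -!(scalemxAl, scalemxAr) !(addE, scaleE); ring.
have -> : (v *m (A + A^T) *m w^T) 0 0 = q v w + q w v.
  rewrite /q mulmxDr mulmxDl mxE; congr (_ + _).
  by rewrite -[in RHS](trmxK (w *m A *m v^T)) [in RHS]mxE !trmx_mul trmxK mulmxA.
apply: is_derive_eq; rewrite /GRing.scale /=; ring.
Qed.

(* If the limiting form is degenerate, its kernel reaches outside of K; otherwise
   phi composed with its inverse is the identity outside of K. *)
Lemma asymptotically_linear_zero (R : realType) k (K : set 'rV[R]_k) (B : 'M[R]_k)
    (phi : 'I_k -> 'rV[R]_k -> R) :
  compact K -> (forall j, continuous (phi j)) ->
  (forall j v, ~ K v -> phi j v = (v *m B) 0 j) ->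
  exists v, forall j, phi j v = 0.
Proof.
move=> /compact_bounded[r0 [_ Kr]] cphi phiB.
(* [K] is bounded by every number above [r0], in particular by [|r0| + 1]; one more unit puts all
   points of norm at least [r] outside of [K]. *)
pose r : R := `|r0| + 2.
have r_gt0 : 0 < r by rewrite ltr_wpDl.
have NK v : r <= `|v| -> ~ K v.
  have r01 : r0 < `|r0| + 1 by rewrite (le_lt_trans (ler_norm _)) // ltrDl.
  move=> rv /(Kr _ r01) /=; apply/negP; rewrite -ltNge (lt_le_trans _ rv) //.
  by rewrite ltrD2l ltr1n.
have [Bu|] := boolP (B \in unitmx); last first.
  rewrite unitmxE unitfE negbK => /det0P[u u0 uB].
  exists ((r / `|u|) *: u) => j.
  rewrite phiB ?linearZ -?scalemxAl ?uB ?scaler0 ?mxE //.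
  apply: NK; rewrite normrZ ger0_norm ?(divr_ge0 (ltW r_gt0)) //.
  by rewrite divfK // normr_eq0.
pose psi j v := \sum_l phi l v * invmx B l j.
have psiE j v : ~ K v -> psi j v = v 0 j.
  move=> Kv; rewrite -[in RHS](mulmxK Bu v) mxE; apply: eq_bigr => l _.
  by rewrite phiB.
have coordK (v : 'rV[R]_k) j : `|v 0 j| = r -> ~ K v.
  move=> vj; apply: NK; rewrite -vj [leRHS]/Num.Def.normr /= mx_normrE.
  exact: (le_bigmax _ _ (ord0, j)).
have [|||v psi0] := @poincare_miranda R k r psi r_gt0.
- move=> j; apply: continuous_big => [|l _ v]; first exact: add_continuous.
  exact: (cvgM (cphi l v) (cvg_cst _)).
- by move=> j v vj; rewrite psiE ?vj //; apply: (coordK v j); rewrite vj gtr0_norm.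
- move=> j v vj; rewrite psiE ?vj ?oppr_lt0 //; apply: (coordK v j).
  by rewrite vj normrN gtr0_norm.
exists v => j.
have phi0 : (\row_l phi l v) *m invmx B = 0.
  apply/rowP => l; rewrite [RHS]mxE -[RHS](psi0 l) mxE.
  by apply: eq_bigr => m _; rewrite mxE.
have := congr1 (fun u => (u *m B) 0 j) phi0.
by rewrite mulmxKV // mul0mx !mxE.
Qed.

(** * Projection of L_F to the base manifold *)

Section Charts.
Context (R : realType) (n : nat) (X : charted R n).
Hypothesis manX : is_manifold X.

(** The image of a chart is open by the axiom on transition maps applied to a chart and itself. *)
Lemma chart_paramK_near a (x : X) : chart_dom a x ->
  \forall v \near chart a x, chart_dom a (param a v) /\ chart a (param a v) = v.
Proof.
case: manX => _ paramK charts _ _ ax.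
have [oa _] := charts a a.
have : nbhs (chart a x) (chart a @` (chart_dom a `&` chart_dom a)).
  by apply: open_nbhs_nbhs; split=> //; exists x.
by apply: filterS => _ [y [ay _] <-]; rewrite paramK.
Qed.

End Charts.

Section Projection.
Context (R : realType) (n k : nat) (M : charted R n) (beta : form1 M).
Hypothesis manM : is_manifold M.
Local Notation MRk := (prod_charted M (euclid R k)).

Lemma tangent_map_base_proj (z : MRk) w :
  tangent_map (@base_proj R n k M) z w = lsubmx w.
Proof.
rewrite /tangent_map; apply: derive_val.
apply: (is_derive_near_affine (l := lsubmx) (b := 0)).
case: (manM) => at_dom _ _ _ _.
pose P v := chart_dom (chart_at z.1) (param (chart_at z.1) v) /\
  chart (chart_at z.1) (param (chart_at z.1) v) = v.
have nearP : \forall v \near lsubmx (chart (chart_at z) z), P v.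
  by rewrite /= row_mxKl; exact: chart_paramK_near.
have {}nearP : \forall v \near chart (chart_at z) z, P (lsubmx v).
  exact: (@continuous_lsubmx R 1 n k _ P nearP).
by apply: filterS nearP => v [_ vK]; rewrite addr0.
Qed.

(** At a critical point [v] of F(x, .), the covector [d_beta F] is horizontal: the correction
    [F * beta] has no R^k components, [beta] being pulled back from [M]. Its [M] components give the
    point of L_F over [x]. *)
Lemma generated_lagrangian_onto (F : MRk -> R) (x : M) :
  generating_function beta F -> exists2 q, generated_lagrangian beta F q & q.1 = x.
Proof.
move=> [smF [K cK quadF] _].
case: (manM) => at_dom paramK _ _ _.
pose a : atlas MRk := (chart_at x, tt).
pose c := chart (chart_at x) x.
pose G := F \o param a.
have GE v : G (row_mx c v) = F (x, v).
  by rewrite /G /= row_mxKl row_mxKr paramK.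
pose phi j (v : 'rV[R]_k) := 'D_(basis_vec R (rshift n j)) G (row_mx c v).
have Uc v : (chart a @` chart_dom a) (row_mx c v).
  by exists (x, v) => //; split=> //; exact: at_dom.
have cphi j : continuous (phi j).
  move=> v; have [_ /(_ (rshift n j))[_ [cG _]]] := smF a 1%N.
  have crow : {for v, continuous (row_mx c : 'rV[R]_k -> 'rV[R]_(n + k))}.
    exact: (continuous_row_mx (@cst_continuous _ _ c v) (@cvg_id _ (nbhs v))).
  exact: (continuous_comp crow (cG _ (Uc v))).
have [A quadx] := quadF x.
have [|v crit] := asymptotically_linear_zero (B := A + A^T) cK cphi.
  move=> j v Kv.
  (* The complement of [K] is open, so F(x, .) agrees with the quadratic form on a neighbourhood of
     [v] and has the same derivative there. *)
  have oK : \forall u \near v, ~ K u.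
    have : open (~` K).
      by apply: closed_openC; apply: compact_closed cK; exact: norm_hausdorff.
    by rewrite openE; exact.
  rewrite /phi; apply: derive_val; apply/is_derive_line.
  have -> : (fun h : R => G (h *: basis_vec R (rshift n j) + row_mx c v)) =
      (fun h => F (x, h *: basis_vec R j + v)).
    apply/funext => h; rewrite -GE /basis_vec delta_mx_rshift.
    by rewrite scale_row_mx add_row_mx scaler0 add0r.
  apply/(is_derive_line (fun u => F (x, u))).
  rewrite (_ : _ 0 j = (v *m (A + A^T) *m (basis_vec R j)^T) 0 0).
    apply: near_eq_is_derive (is_derive_quadratic_form A v (basis_vec R j)).
    by apply: filterS oK => u /quadx.
  by rewrite /basis_vec trmx_delta -colE [RHS]mxE.
exists (x, lsubmx (d_beta beta F (x, v))) => //.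
have vert w : pairing (d_beta beta F (x, v)) w =
    pairing (lsubmx (d_beta beta F (x, v))) (lsubmx w).
  rewrite /pairing big_split_ord /= [X in _ + X]big1 ?addr0.
    by apply: eq_bigr => i _; rewrite !mxE.
  move=> j _; rewrite !mxE.
  rewrite [X in X - _](_ : _ = phi j v) // crit sub0r.
  rewrite tangent_map_base_proj /pairing big1 ?mulr0 ?oppr0 ?mul0r // => i _.
  by rewrite !mxE eq_lrshift andbF mulr0n mulr0.
exists (section1 (d_beta beta F) (x, v)); last first.
  by split=> // w; rewrite tangent_map_base_proj; exact: vert.
split; first by exists (x, v).
move=> w /=; rewrite tangent_map_base_proj => w0; rewrite vert w0.
by rewrite /pairing big1 // => i _; rewrite [X in _ * X]mxE mulr0.
Qed.
End Projection.

(** * Smooth maps *)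

Section Ck.
Context (R : realType) (n : nat).
Implicit Types (f g : 'rV[R]_n -> R) (U : set 'rV[R]_n).

Lemma is_derive_coord (v w : 'rV[R]_n) j :
  is_derive v w (fun u : 'rV[R]_n => u 0 j) (w 0 j).
Proof.
apply/is_derive_line.
rewrite (_ : (fun _ => _) = (fun h : R => h * w 0 j + v 0 j)); last first.
  by apply/funext => h; rewrite !mxE.
by apply: is_derive_eq; rewrite /GRing.scale /= mulr1 mulr0 add0r addr0.
Qed.

Lemma is_derive_comp_coord (h : R -> R) (d : R) (v w : 'rV[R]_n) j :
  is_derive (v 0 j) 1 h d ->
  is_derive v w (fun u : 'rV[R]_n => h (u 0 j)) (w 0 j * d).
Proof.
move=> hd; apply/is_derive_line.
rewrite (_ : (fun _ => _) = h \o (fun t : R => t * w 0 j + v 0 j)); last first.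
  by apply/funext => t; rewrite /= !mxE.
rewrite mulrC; apply: is_derive1_comp; first by rewrite mul0r add0r.
by apply: is_derive_eq; rewrite /GRing.scale /= mulr1 mulr0 add0r addr0.
Qed.

Lemma Ck_pred k U f : Ck k.+1 U f -> Ck k U f.
Proof.
elim: k f => [|k IHk] f [cf df]; first by split.
by split=> // j; have [dj /IHk] := df j; split.
Qed.

Lemma near_eq_cvg_at (T S : topologicalType) (f g : T -> S) (x : T) (l : S) :
  (\forall y \near x, f y = g y) ->
  g y @[y --> x] --> l -> f y @[y --> x] --> l.
Proof.
move=> fg; apply: cvg_trans; apply: near_eq_cvg.
by apply: filterS fg => y ->.
Qed.

Lemma near_eq_continuous_at (T S : topologicalType) (f g : T -> S) (x : T) :
  (\forall y \near x, f y = g y) -> {for x, continuous g} ->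
  {for x, continuous f}.
Proof.
move=> fg; rewrite /prop_for /continuous_at (nbhs_singleton fg).
exact: near_eq_cvg_at.
Qed.

(** Equality near [v] passes to the derivatives near [v], so being C^k is local. This lets chart
    expressions, given by a formula only near each point, be replaced by functions on all of R^n. *)
Lemma Ck_near k U f :
  (forall v, U v -> exists2 g, Ck k setT g & \forall u \near v, f u = g u) ->
  Ck k U f.
Proof.
elim: k f => [|k IHk] f fg; split=> //.
- by move=> v /fg[g [cg _] fgv]; exact: near_eq_continuous_at fgv (cg v I).
- by move=> v /fg[g [cg _] fgv]; exact: near_eq_continuous_at fgv (cg v I).
move=> j; split=> [v /fg[g [_ /(_ j)[dg _]] fgv]|].
  by apply: near_eq_derivable (dg v I); apply: filterS fgv => u ->.
apply: IHk => v /fg[g [_ /(_ j)[_ dg]] fgv].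
exists (fun u => 'D_(basis_vec R j) g u) => //.
move/near_join: fgv; apply: filterS => u; exact: near_eq_derive.
Qed.

Lemma Ck_cst k c : Ck k setT (fun _ : 'rV[R]_n => c).
Proof.
elim: k c => [|k IHk] c; split=> //; try by move=> v _; exact: cst_continuous.
move=> j; split=> [v _|]; first exact: derivable_cst.
rewrite (_ : 'D_(basis_vec R j) _ = fun=> 0); first exact: IHk.
by apply/funext => v; exact: derive_cst.
Qed.

Lemma CkD k f g : Ck k setT f -> Ck k setT g -> Ck k setT (fun v => f v + g v).
Proof.
elim: k f g => [|k IHk] f g [cf df] [cg dg]; split=> //.
- by move=> v _; apply: continuousD; [exact: cf|exact: cg].
- by move=> v _; apply: continuousD; [exact: cf|exact: cg].
move=> j; have [dfj Df] := df j; have [dgj Dg] := dg j; split=> [v _|].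
  by apply: derivableD; [exact: dfj|exact: dgj].
rewrite (_ : 'D_(basis_vec R j) _ =
    (fun v => 'D_(basis_vec R j) f v + 'D_(basis_vec R j) g v)); first exact: IHk.
by apply/funext => v; rewrite deriveD //; [exact: dfj|exact: dgj].
Qed.

Lemma CkM k f g : Ck k setT f -> Ck k setT g -> Ck k setT (fun v => f v * g v).
Proof.
elim: k f g => [|k IHk] f g Cf Cg; have [cf df] := Cf; have [cg dg] := Cg;
  split=> //.
- by move=> v _; apply: continuousM; [exact: cf|exact: cg].
- by move=> v _; apply: continuousM; [exact: cf|exact: cg].
move=> j; have [dfj Df] := df j; have [dgj Dg] := dg j; split=> [v _|].
  by apply: derivableM; [exact: dfj|exact: dgj].
rewrite (_ : 'D_(basis_vec R j) _ =
    (fun v => f v * 'D_(basis_vec R j) g v + g v * 'D_(basis_vec R j) f v)).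
  by apply: CkD; apply: IHk => //; exact: Ck_pred.
by apply/funext => v; rewrite deriveM //; [exact: dfj|exact: dgj].
Qed.

Lemma Ck_coord k j : Ck k setT (fun v : 'rV[R]_n => v 0 j).
Proof.
case: k => [|k]; split=> //; try by move=> v _; exact: coord_continuous.
move=> l; split=> [v _|].
  by have [] := is_derive_coord v (basis_vec R l) j.
rewrite (_ : 'D_(basis_vec R l) _ = fun=> basis_vec R l 0 j); first exact: Ck_cst.
by apply/funext => v; have [_] := is_derive_coord v (basis_vec R l) j.
Qed.

(** Sine and cosine go through the induction together, each being up to sign the derivative of the
    other. *)
Lemma Ck_trig k j :
  Ck k setT (fun v : 'rV[R]_n => sin (v 0 j)) /\
  Ck k setT (fun v : 'rV[R]_n => cos (v 0 j)).
Proof.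
have csin (v : 'rV[R]_n) : {for v, continuous (fun v : 'rV[R]_n => sin (v 0 j))}.
  by apply: continuous_comp; [exact: coord_continuous|exact: continuous_sin].
have ccos (v : 'rV[R]_n) : {for v, continuous (fun v : 'rV[R]_n => cos (v 0 j))}.
  by apply: continuous_comp; [exact: coord_continuous|exact: continuous_cos].
elim: k => [|k [IHs IHc]]; first by split; split=> // v _.
have dsin v w := is_derive_comp_coord w (is_derive_sin ((v : 'rV[R]_n) 0 j)).
have dcos v w := is_derive_comp_coord w (is_derive_cos ((v : 'rV[R]_n) 0 j)).
split; split=> [v _ //|l]; split=> [v _|].
- by have [] := dsin v (basis_vec R l).
- rewrite (_ : 'D_(basis_vec R l) _ = fun v => basis_vec R l 0 j * cos (v 0 j)).
    by apply: CkM => //; exact: Ck_cst.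
  by apply/funext => v; have [_] := dsin v (basis_vec R l).
- by have [] := dcos v (basis_vec R l).
- rewrite (_ : 'D_(basis_vec R l) _ = fun v => - basis_vec R l 0 j * sin (v 0 j)).
    by apply: CkM => //; exact: Ck_cst.
  by apply/funext => v; have [_ ->] := dcos v (basis_vec R l); rewrite mulrN mulNr.
Qed.

End Ck.

Lemma smooth_on_rV_near (R : realType) n m (U : set 'rV[R]_n)
    (f : 'rV[R]_n -> 'rV[R]_m) :
  (forall v, U v -> exists2 g, smooth_on_rV setT g & \forall u \near v, f u = g u) ->
  smooth_on_rV U f.
Proof.
move=> fg c k; apply: Ck_near => v /fg[g smg fgv].
by exists (fun u => g u 0 c); [exact: smg|apply: filterS fgv => u ->].
Qed.

Lemma smooth_row_mx (R : realType) n m1 m2 (f : 'rV[R]_n -> 'rV[R]_m1)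
    (g : 'rV[R]_n -> 'rV[R]_m2) :
  smooth_on_rV setT f -> smooth_on_rV setT g ->
  smooth_on_rV setT (fun u => row_mx (f u) (g u)).
Proof.
move=> smf smg c k.
rewrite (_ : (fun _ => _) = fun u =>
  match fintype.split c with inl i => f u 0 i | inr i => g u 0 i end).
  by case: (fintype.split c) => i; [exact: smf|exact: smg].
by apply/funext => u; rewrite mxE; case: fintype.split.
Qed.

Lemma smooth_addr (R : realType) n m (f : 'rV[R]_n -> 'rV[R]_m) d :
  smooth_on_rV setT f -> smooth_on_rV setT (fun u => f u + d).
Proof.
move=> smf c k; under eq_fun do rewrite mxE.
by apply: CkD; [exact: smf|exact: Ck_cst].
Qed.

Lemma smooth_cst (R : realType) n m (c : 'rV[R]_m) :
  smooth_on_rV setT (fun _ : 'rV[R]_n => c).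
Proof. by move=> j k; exact: Ck_cst. Qed.

Lemma smooth_id (R : realType) n : smooth_on_rV setT (@id 'rV[R]_n).
Proof. by move=> j k; exact: Ck_coord. Qed.

Lemma is_derive_rV (R : realType) (V : normedModType R) m (f : V -> 'rV[R]_m)
    (v w : V) (d : 'rV[R]_m) :
  (forall j, is_derive v w (fun u => f u 0 j) (d 0 j)) -> is_derive v w f d.
Proof.
move=> df; have dvf : derivable f v w.
  by apply/derivable_mxP => i j; rewrite ord1; have [] := df j.
split=> //; rewrite derive_mx //; apply/rowP => j; rewrite mxE.
by have [_] := df j.
Qed.

Lemma is_derive_row_mx (R : realType) (V : normedModType R) m1 m2
    (f : V -> 'rV[R]_m1) (g : V -> 'rV[R]_m2) (v w : V)
    (df : 'rV[R]_m1) (dg : 'rV[R]_m2) :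
  (forall j, is_derive v w (fun u => f u 0 j) (df 0 j)) ->
  (forall j, is_derive v w (fun u => g u 0 j) (dg 0 j)) ->
  is_derive v w (fun u => row_mx (f u) (g u)) (row_mx df dg).
Proof.
move=> dfj dgj; apply: is_derive_rV => j; rewrite mxE.
rewrite (_ : (fun _ => _) = fun u =>
  match fintype.split j with inl i => f u 0 i | inr i => g u 0 i end).
  by case: (fintype.split j).
by apply/funext => u; rewrite mxE; case: fintype.split.
Qed.

(** * The topology defined by an atlas *)

Lemma continuous_inj_hausdorff (T U : topologicalType) (f : T -> U) :
  continuous f -> injective f -> hausdorff_space U -> hausdorff_space T.
Proof.
move=> cf injf hU p q pq; apply: injf; apply: hU => A B /cf nA /cf nB.
by have [x [Ax Bx]] := pq _ _ nA nB; exists (f x).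
Qed.

Section ChartedTopology.
Context (R : realType) (n : nat) (X : charted R n).

Lemma charted_openE (W : set X) : open W = atlas_open W.
Proof. by []. Qed.

Lemma param_cvg (a : atlas X) (x : X) : chart_dom a x ->
  param a v @[v --> chart a x] --> x.
Proof.
move=> ax W; rewrite nbhsE => -[V [+ Vx] VW].
rewrite charted_openE => oV.
by apply: filterS (oV a x ax Vx) => v /VW.
Qed.

(** Open sets are defined through the maps [param a], so continuity can be tested after composition
    with them. *)
Lemma charted_continuous (T : topologicalType) (f : X -> T) :
  (forall a x, chart_dom a x -> f (param a v) @[v --> chart a x] --> f x) ->
  continuous f.
Proof.
move=> cf; apply/continuousP => W oW; rewrite charted_openE => a x ax Wfx.
by apply: (cf a x ax); exact: open_nbhs_nbhs.
Qed.

End ChartedTopology.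

(** * The torus *)

Section Wrap.
Context (R : realType).

Definition tau : R := pi *+ 2.

Lemma tau_gt0 : 0 < tau.
Proof. by rewrite mulrn_wgt0 // pi_gt0. Qed.

Definition mod_tau (x : R) : R := x - (Num.floor (x / tau))%:~R * tau.

Lemma mod_tau_itv x : 0 <= mod_tau x < tau.
Proof.
have /andP[fl fu] := floor_itv (x / tau).
rewrite subr_ge0 ltrBlDr -[X in X + _]mul1r -mulrDl.
rewrite -ler_pdivlMr ?tau_gt0 // fl -ltr_pdivrMr ?tau_gt0 //.
by rewrite addrC -intrD1.
Qed.

Definition cong_tau (x y : R) := exists m : int, x - y = m%:~R * tau.

Lemma cong_mod_tau x : cong_tau x (mod_tau x).
Proof. by exists (Num.floor (x / tau)); rewrite opprD addrA subrr sub0r opprK. Qed.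

Lemma cong_tauD (x y x' y' : R) :
  cong_tau x y -> cong_tau x' y' -> cong_tau (x + x') (y + y').
Proof.
by move=> [m xy] [p xy']; exists (m + p); rewrite intrD mulrDl -xy -xy'; ring.
Qed.

Lemma cong_tauN (x y : R) : cong_tau x y -> cong_tau (- x) (- y).
Proof. by move=> [m xy]; exists (- m); rewrite mulrNz mulNr -xy; ring. Qed.

Lemma cong_tau_refl x : cong_tau x x.
Proof. by exists 0; rewrite subrr mul0r. Qed.

Lemma cong_tau_sym x y : cong_tau x y -> cong_tau y x.
Proof. by move=> [m xy]; exists (- m); rewrite mulrNz mulNr -xy; ring. Qed.

Lemma cong_tau_trans y x z : cong_tau x y -> cong_tau y z -> cong_tau x z.
Proof.
by move=> [m xy] [p yz]; exists (m + p); rewrite intrD mulrDl -xy -yz; ring.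
Qed.

Lemma cong_tau_eq x y : `|x - y| < tau -> cong_tau x y -> x = y.
Proof.
move=> + [m xy]; rewrite xy normrM (gtr0_norm tau_gt0) gtr_pMl ?tau_gt0 //.
rewrite -intr_norm -[1]/(1%:~R) ltr_int => m1; apply/eqP; rewrite -subr_eq0 xy.
suff -> : m = 0 by rewrite mul0r.
by apply/eqP; rewrite -normr_le0 -ltzD1 add0r.
Qed.

Lemma mod_tauP x y : mod_tau x = mod_tau y <-> cong_tau x y.
Proof.
split=> [e|xy].
  apply: cong_tau_trans (cong_mod_tau x) _; rewrite e.
  exact/cong_tau_sym/cong_mod_tau.
apply: cong_tau_eq; last first.
  apply: cong_tau_trans (cong_tau_sym (cong_mod_tau x)) _.
  exact: cong_tau_trans xy (cong_mod_tau y).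
have /andP[x0 x1] := mod_tau_itv x; have /andP[y0 y1] := mod_tau_itv y.
by rewrite ltr_norml; apply/andP; split; lra.
Qed.

Lemma cong_tau_trig (x y : R) : cong_tau x y -> sin x = sin y /\ cos x = cos y.
Proof.
move=> [m /eqP]; rewrite subr_eq addrC => /eqP ->; case: m => p.
  rewrite -pmulrn mulr_natl; split; apply: periodicn;
    [exact: sinD2pi|exact: cosD2pi].
rewrite NegzE mulrNz mulNr -pmulrn mulr_natl.
by split; rewrite -[in RHS](subrK (tau *+ p.+1) y); apply/esym/periodicn;
    [exact: sinD2pi|exact: cosD2pi].
Qed.

(** The addition formula gives cos (x - y) = 1. The representative [d] of x - y in [0, tau) is then
    0, as cosine is injective on [0, pi], which contains [d] or [tau - d]. *)
Lemma trig_cong_tau (x y : R) : sin x = sin y -> cos x = cos y -> cong_tau x y.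
Proof.
move=> sxy cxy; have cos1 : cos (x - y) = 1.
  by rewrite cosB sxy cxy -!expr2 cos2Dsin2.
pose d := mod_tau (x - y).
have /andP[d0 dt] := mod_tau_itv (x - y); rewrite -/d in d0 dt.
have cosd : cos d = 1.
  by rewrite -cos1; have [_ ->] := cong_tau_trig (cong_mod_tau (x - y)).
suff d_eq0 : d = 0.
  by have [m] := cong_mod_tau (x - y); rewrite -/d d_eq0 subr0 => xy; exists m.
have [d_pi|pi_d] := leP d pi.
  by apply: cos_inj; rewrite ?in_itv /= ?d0 ?d_pi ?lexx ?pi_ge0 ?cos0.
have : tau - d = 0.
  apply: cos_inj; rewrite ?in_itv /= ?lexx ?pi_ge0 //.
    by apply/andP; split; rewrite /tau in dt *; lra.
  by rewrite cos0 -cosd -[RHS]cosN -[RHS](cosD2pi (- d)) addrC.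
by move=> /eqP; rewrite subr_eq0 => /eqP td; rewrite -td ltxx in dt.
Qed.

End Wrap.

(** * The torus as a closed manifold *)

Section Torus.
Context (R : realType) (n : nat).
Local Notation tau := (tau R).

Definition wrap (v : 'rV[R]_n) : 'rV[R]_n := map_mx (@mod_tau R) v.

Definition cong_row (v w : 'rV[R]_n) := forall j, cong_tau (v 0 j) (w 0 j).

Lemma wrapP v w : wrap v = wrap w <-> cong_row v w.
Proof.
split=> [vw j|vw]; first by have /rowP/(_ j) := vw; rewrite !mxE => /mod_tauP.
by apply/rowP => j; rewrite !mxE; apply/mod_tauP.
Qed.

Lemma cong_wrap v : cong_row v (wrap v).
Proof. by move=> j; rewrite mxE; exact: cong_mod_tau. Qed.

Lemma wrapK v : wrap (wrap v) == wrap v.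
Proof. by apply/eqP/wrapP => j; apply: cong_tau_sym; exact: cong_wrap. Qed.

(** The representative of [x] in the half-open cube [c, c + tau)^n. *)
Definition torus_chart (c : 'rV[R]_n) (x : {v : 'rV[R]_n | wrap v == v}) :=
  c + wrap (val x - c).

(* R^n modulo tau, represented by the cube [0, tau)^n.  The chart with corner c
   takes values in the open cube (c, c + tau)^n. *)
Definition torus : charted R n :=
  @Charted R n {v : 'rV[R]_n | wrap v == v} 'rV[R]_n
    (fun c => [set x | forall j, c 0 j < torus_chart c x 0 j])
    torus_chart
    (fun _ v => exist _ (wrap v) (wrapK v))
    (fun x => val x - const_mx pi).

Definition quot (v : 'rV[R]_n) : torus := exist _ (wrap v) (wrapK v).

Lemma quot_eqP v w : quot v = quot w <-> cong_row v w.
Proof.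
by split=> [/(congr1 val)/wrapP//|vw]; apply: val_inj; exact/wrapP.
Qed.

Lemma paramE (c : atlas torus) v : param c v = quot v. Proof. by []. Qed.

Lemma quot_val (x : torus) : quot (val x) = x.
Proof. by apply: val_inj; rewrite /=; apply/eqP; case: x. Qed.

Lemma chartE (c : atlas torus) (x : torus) : chart c x = c + wrap (val x - c).
Proof. by []. Qed.

Lemma cong_chart (c : atlas torus) v : cong_row v (chart c (quot v)).
Proof.
move=> j; rewrite chartE !mxE /=; apply: cong_tau_trans (cong_mod_tau (v 0 j)) _.
have := cong_tauD (cong_tau_refl (c 0 j)) (cong_mod_tau (mod_tau (v 0 j) - c 0 j)).
by rewrite addrCA subrr addr0.
Qed.

Lemma chartK (c : atlas torus) (x : torus) : quot (chart c x) = x.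
Proof.
rewrite -[in RHS](quot_val x); apply/quot_eqP => j; apply: cong_tau_sym.
by have := cong_chart c (val x) j; rewrite quot_val.
Qed.

Lemma chart_quot (c : atlas torus) (v : 'rV[R]_n) :
  (forall j, c 0 j <= v 0 j < c 0 j + tau) -> chart c (quot v) = v.
Proof.
move=> cv; apply/rowP => j; apply: cong_tau_eq; last first.
  by apply: cong_tau_sym; exact: cong_chart.
rewrite chartE !mxE /=.
have /andP[m0 mt] := mod_tau_itv (mod_tau (v 0 j) - c 0 j).
have /andP[cv1 cv2] := cv j.
by rewrite ltr_norml; apply/andP; split; lra.
Qed.

Lemma chart_lt (c : atlas torus) (x : torus) j : chart c x 0 j < c 0 j + tau.
Proof.
by rewrite chartE !mxE ltrD2l; have /andP[] := mod_tau_itv (val x 0 j - c 0 j).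
Qed.

Lemma quot_dom (c : atlas torus) (v : 'rV[R]_n) :
  (forall j, c 0 j < v 0 j < c 0 j + tau) -> chart_dom c (quot v).
Proof.
move=> cv j; rewrite -[torus_chart _ _]/(chart c (quot v)) chart_quot.
  by have /andP[] := cv j.
by move=> l; have /andP[/ltW -> ->] := cv l.
Qed.

(** Near [v] a chart composed with [quot] is the translation by a fixed period. All local
    computations on the torus rest on this. *)
Lemma chart_quot_near (c : atlas torus) v : chart_dom c (quot v) ->
  \forall u \near v, chart_dom c (quot u) /\
    chart c (quot u) = u + (chart c (quot v) - v).
Proof.
move=> cv; set d := chart c (quot v) - v.
have vd j : c 0 j < (v + d) 0 j < c 0 j + tau.
  by rewrite /d subrKC chart_lt andbT; exact: cv.
have ud : \forall u \near v, forall j, c 0 j < (u + d) 0 j < c 0 j + tau.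
  apply: (@filter_forall _ _
    (fun j u => c 0 j < (u + d) 0 j < c 0 j + tau) (nbhs v)) => j.
  have cont : (u + d) 0 j @[u --> v] --> (v + d) 0 j.
    rewrite mxE; under eq_fun do rewrite mxE.
    exact: (cvgD (@coord_continuous R 1 n 0 j v) (cvg_cst (d 0 j))).
  have /andP[v1 v2] := vd j.
  near=> u; apply/andP; split; near: u.
    exact: cvgr_gt cont _ v1.
  exact: cvgr_lt cont _ v2.
apply: filterS ud => u ud.
have -> : quot u = quot (u + d).
  apply/quot_eqP => j; have := cong_tauD (cong_tau_refl (u 0 j)) (cong_chart c v j).
  have := cong_tau_refl (v 0 j).
  move=> /cong_tauN vv /cong_tauD/(_ vv); rewrite !mxE.
  by rewrite addrK addrA.
split; first exact: quot_dom.
by apply: chart_quot => j; have /andP[/ltW -> ->] := ud j.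
Unshelve. all: by end_near. Qed.

(** The preferred chart has [val x] at the centre of its cube. *)
Lemma chart_at_val (x : torus) : chart (chart_at x) x = val x.
Proof.
rewrite -[in LHS](quot_val x) quot_val -[X in chart _ X](quot_val x).
apply: chart_quot => j; rewrite !mxE /= /Torus.tau.
have := pi_gt0 R; move=> pi0; apply/andP; split; lra.
Qed.

Lemma chart_at_dom (x : torus) : chart_dom (chart_at x) x.
Proof.
move=> j; rewrite -[torus_chart _ _]/(chart (chart_at x) x) chart_at_val !mxE.
by rewrite ltrBlDr ltrDl pi_gt0.
Qed.

(** The translation by the period [w - v] carries neighbourhoods of [v] to neighbourhoods of [w] and
    preserves classes. *)
Lemma quot_near (P : set torus) v w : quot v = quot w ->
  (\forall u \near w, P (quot u)) -> \forall u \near v, P (quot u).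
Proof.
move=> /quot_eqP vw Pw.
have cont : (u + (w - v)) @[u --> v] --> v + (w - v).
  exact: (cvgD (@cvg_id _ (nbhs v)) (cvg_cst (w - v))).
rewrite subrKC in cont.
have near_v : \forall u \near v, P (quot (u + (w - v))) := cont _ Pw.
apply: filterS near_v => u; congr P; apply/quot_eqP => j.
have := cong_tauD (cong_tau_refl (u 0 j - v 0 j)) (cong_tau_sym (vw j)).
by rewrite subrK !mxE addrAC addrA.
Qed.

(** The atlas topology is thus the quotient topology of R^n. *)
Lemma torus_openP (W : set torus) :
  open W <-> forall v, W (quot v) -> \forall u \near v, W (quot u).
Proof.
rewrite charted_openE; split=> [oW v Wv|oW c x cx Wx].
  apply: (@quot_near W v (val (quot v))); first by rewrite quot_val.
  by have := oW _ _ (chart_at_dom (quot v)) Wv; rewrite chart_at_val.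
by apply: oW; rewrite chartK.
Qed.

Lemma continuous_quot : continuous quot.
Proof.
apply/continuousP => W /torus_openP oW; rewrite openE => v Wv.
exact: oW.
Qed.

Lemma open_quot (O : set 'rV[R]_n) : open O -> open (quot @` O).
Proof.
move=> oO; apply/torus_openP => v [w Ow wv].
apply: (quot_near (P := quot @` O) (esym wv)).
by apply: filterS (open_nbhs_nbhs (conj oO Ow)) => u Ou; exists u.
Qed.

Lemma torus_compact : compact [set: torus].
Proof.
have box_compact :=
  @rV_compact R n (fun=> `[0, tau]%classic) (fun=> @segment_compact _ _ _).
rewrite (_ : setT =
    quot @` [set v : 'rV[R]_n | forall i, `[0, tau]%classic (v ord0 i)]).
  apply: continuous_compact box_compact.
  by apply: continuous_subspaceT; exact: continuous_quot.
apply/seteqP; split=> // x _; exists (val x); last exact: quot_val.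
move=> j /=; rewrite in_itv /=; have /eqP <- := valP x; rewrite mxE.
by have /andP[-> /ltW ->] := mod_tau_itv (val x 0 j).
Qed.

(** The images of the lines through the origin cover the torus and share the point [quot 0]. *)
Lemma torus_connected : connected [set: torus].
Proof.
pose line v := (fun t : R => quot (t *: v)) @` setT.
rewrite (_ : setT = \bigcup_(v in setT) line v).
  apply: bigcup_connected.
    by exists (quot 0) => v _; exists 0 => //; rewrite scale0r.
  move=> v _; apply: connected_continuous_connected.
    by apply/connected_intervalP.
  apply: continuous_subspaceT => t.
  apply: continuous_comp; last exact: continuous_quot.
  exact: scalel_continuous.
apply/seteqP; split=> // x _; exists (val x) => //; exists 1 => //.
by rewrite scale1r quot_val.
Qed.

(** Induces a continuous injection of the torus into R^(2n), from which the Hausdorff property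
    follows. *)
Definition trig (v : 'rV[R]_n) : 'rV[R]_(n + n) :=
  row_mx (map_mx (@cos R) v) (map_mx (@sin R) v).

Lemma trigP v w : trig v = trig w <-> quot v = quot w.
Proof.
split=> [/eq_row_mx[/rowP cvw /rowP svw]|/quot_eqP vw].
  apply/quot_eqP => j; apply: trig_cong_tau.
    by have := svw j; rewrite !mxE.
  by have := cvw j; rewrite !mxE.
by congr row_mx; apply/rowP => j; rewrite !mxE; have [] := cong_tau_trig (vw j).
Qed.

Lemma continuous_trig : continuous trig.
Proof.
move=> v; apply: continuous_rV => j.
rewrite (_ : (fun _ => _) = fun u : 'rV[R]_n =>
  match fintype.split j with inl i => cos (u 0 i) | inr i => sin (u 0 i) end).
  by case: (fintype.split j) => i; apply: continuous_comp;
    [exact: coord_continuous|exact: continuous_cos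
    |exact: coord_continuous|exact: continuous_sin].
by apply/funext => u; rewrite mxE; case: fintype.split => i; rewrite mxE.
Qed.

Lemma trig_val v : trig (val (quot v)) = trig v.
Proof. by apply/trigP; rewrite quot_val. Qed.

Lemma torus_hausdorff : hausdorff_space torus.
Proof.
apply: (@continuous_inj_hausdorff torus 'rV[R]_(n + n)
  (fun x : torus => trig (val x))).
- apply: charted_continuous => c x _.
  rewrite -[in X in _ --> X](chartK c x) /=.
  under eq_fun do rewrite trig_val.
  by rewrite trig_val; exact: continuous_trig.
- by move=> x y /trigP; rewrite !quot_val.
- exact: norm_hausdorff.
Qed.

Lemma torus_second_countable : @second_countable torus.
Proof.
pose B (qm : 'rV[rat]_n * nat) : set torus :=
  quot @` ball (map_mx ratr qm.1 : 'rV[R]_n) (qm.2.+1%:R^-1).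
exists (range B).
  apply: sub_countable (countableP (@setT ('rV[rat]_n * nat)%type)).
  exact: card_image_le.
split=> [_ [qm _ <-]|x A /= nA].
  by apply: open_quot; exact: ball_open.
have cq : quot u @[u --> val x] --> quot (val x) by exact: continuous_quot.
rewrite quot_val in cq.
have : \forall u \near val x, A (quot u) := cq _ nA.
move=> /nbhs_ballP[e /= e0 eA].
(* The radius 1/(m+1) is at most e/2, so a ball of this radius that contains [val x] lies in the
   ball of radius [e] about [val x]. *)
pose m := Num.truncn (e / 2)^-1.
have m0 : 0 < m.+1%:R^-1 :> R by rewrite invr_gt0.
have me : m.+1%:R^-1 <= e / 2.
  by rewrite -[leRHS]invrK lef_pV2 ?posrE ?invr_gt0 ?divr_gt0 // ltW // truncnS_gt.
have q_near (h t : R) : 0 < h -> exists q : rat, `|t - ratr q| < h.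
  move=> h0; have [|q] := @rat_in_itvoo R (t - h) (t + h); first by lra.
  rewrite in_itv /= => /andP[q1 q2]; exists q; rewrite ltr_norml.
  by apply/andP; split; lra.
have [q qP] := choice (fun j => q_near _ (val x 0 j) m0).
pose y : 'rV[R]_n := map_mx ratr (\row_j q j).
have xy : ball y m.+1%:R^-1 (val x).
  rewrite mx_norm_ball /ball_ /= /Num.Def.normr /= mx_normrE.
  by apply/bigmax_ltP; split=> // -[i j] _; rewrite !mxE ord1 distrC.
exists (B (\row_j q j, m)).
  split; first by exists (\row_j q j, m).
  by exists (val x); rewrite ?quot_val.
move=> _ [u yu <-]; apply: eA.
apply: (@le_ball _ _ _ (m.+1%:R^-1 + m.+1%:R^-1)); first by rewrite [e]splitr lerD.
by apply: ball_triangle yu; exact: ball_sym.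
Qed.

Lemma torus_manifold : is_manifold torus.
Proof.
split; [exact: chart_at_dom|by move=> c x _; exact: chartK| |exact: torus_hausdorff
  |exact: torus_second_countable].
move=> a b; split.
  rewrite openE => _ [x [ax bx] <-].
  rewrite -(chartK a x) in ax bx.
  have [na nb] := (chart_quot_near ax, chart_quot_near bx).
  rewrite !chartK in na nb; rewrite /interior.
  apply: filterS2 na nb => u [au aqu] [bu _].
  exists (quot u) => //; by rewrite aqu subrr addr0.
apply: smooth_on_rV_near => _ [x [ax bx] <-].
rewrite -(chartK a x) in bx.
(* Near each point the transition map is a translation. *)
exists (fun u => u + (chart b (quot (chart a x)) - chart a x)).
  exact: smooth_addr (@smooth_id _ _).
by apply: filterS (chart_quot_near bx) => u [_ chartu]; exact: chartu.
Qed.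

Lemma torus_closed_manifold : connected_closed_manifold torus.
Proof.
split; [exact: torus_manifold|by exists (quot 0)|exact: torus_compact|].
exact: torus_connected.
Qed.

End Torus.

(** * The cotangent bundle of the torus *)

Lemma smooth_continuous (R : realType) n m (f : 'rV[R]_n -> 'rV[R]_m) :
  smooth_on_rV setT f -> continuous f.
Proof.
by move=> smf v; apply: continuous_rV => j; have [cf _] := smf j 0%N; exact: cf.
Qed.

Section CotangentTorus.
Context (R : realType) (n : nat).
Local Notation T := (torus R n).

(** Transition maps are local translations, with derivative the identity. Covectors thus have the
    same components in all charts, and T^*T is T x R^n. *)
Lemma change_covector_torus (a b : atlas T) (x : T) xi :
  chart_dom a x -> change_covector a b x xi = xi.
Proof.
move=> ax; apply/rowP => j; rewrite mxE.
have {}ax : chart_dom a (quot (chart b x)) by rewrite chartK.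
rewrite (_ : 'D_(_) _ _ = basis_vec R j); last first.
  apply: derive_val; apply: (is_derive_near_affine (l := idfun)
    (b := chart a (quot (chart b x)) - chart b x)).
  by apply: filterS (chart_quot_near ax) => u [_ chartu]; exact: chartu.
rewrite /pairing (bigD1 j) //= big1 ?addr0 => [|l lj].
  by rewrite !mxE !eqxx mulr1.
by rewrite !mxE (negPf lj) andbF mulr0.
Qed.

(** The covering of the cotangent bundle by R^n x R^n. *)
Definition cot_quot (w : 'rV[R]_(n + n)) : cotangent T :=
  (quot (lsubmx w), rsubmx w).

Lemma cot_chartE (a : atlas T) (p : cotangent T) :
  @chart _ _ (cotangent T) a p = row_mx (chart a p.1) p.2.
Proof. by rewrite /= change_covector_torus //; exact: chart_at_dom. Qed.

Lemma cot_paramE (a : atlas T) w : chart_dom a (quot (lsubmx w)) ->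
  @param _ _ (cotangent T) a w = cot_quot w.
Proof. by move=> aw; rewrite /= change_covector_torus. Qed.

Lemma cot_quotD w d : quot (lsubmx w + d) = quot (lsubmx w) ->
  cot_quot (w + row_mx d 0) = cot_quot w.
Proof. by move=> wd; rewrite /cot_quot !linearD /= row_mxKl row_mxKr addr0 wd. Qed.

Lemma cot_chart_near (a : atlas T) w : chart_dom a (quot (lsubmx w)) ->
  \forall u \near w, chart_dom a (quot (lsubmx u)) /\
    @chart _ _ (cotangent T) a (cot_quot u) =
    u + row_mx (chart a (quot (lsubmx w)) - lsubmx w) 0.
Proof.
move=> aw.
pose P v := chart_dom a (quot v) /\
  chart a (quot v) = v + (chart a (quot (lsubmx w)) - lsubmx w).
have nearP : \forall u \near w, P (lsubmx u).
  exact: (@continuous_lsubmx R 1 n n w P (chart_quot_near aw)).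
apply: filterS nearP => u [au chartu]; split=> //.
by rewrite cot_chartE chartu -[in RHS](hsubmxK u) add_row_mx addr0.
Qed.

Lemma cot_param_near (a : atlas T) (p : cotangent T) : chart_dom a p.1 ->
  \forall v \near @chart _ _ (cotangent T) a p,
    @param _ _ (cotangent T) a v = cot_quot v.
Proof.
move=> ap; rewrite cot_chartE.
have : chart_dom a (quot (lsubmx (row_mx (chart a p.1) p.2))).
  by rewrite row_mxKl chartK.
by move=> /cot_chart_near; apply: filterS => u [/cot_paramE].
Qed.

(** Near a chart value [cot_quot] is a [param], hence continuous there; every other point differs
    from a chart value by a period in the base. *)
Lemma continuous_cot_quot : continuous cot_quot.
Proof.
move=> w; set p := cot_quot w; set a := chart_at p.1.
have ap : chart_dom a p.1 by exact: chart_at_dom.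
have cp : cot_quot v @[v --> @chart _ _ (cotangent T) a p] --> p.
  apply: near_eq_cvg_at (param_cvg (X := cotangent T) (a := a) (x := p) ap).
  by apply: filterS (cot_param_near ap) => v ->.
set d := chart a p.1 - lsubmx w.
have wd : w + row_mx d 0 = @chart _ _ (cotangent T) a p.
  by rewrite cot_chartE -[in LHS](hsubmxK w) add_row_mx addr0 subrKC.
have cw : (u + row_mx d 0) @[u --> w] --> w + row_mx d 0.
  exact: (cvgD (@cvg_id _ (nbhs w)) (cvg_cst (row_mx d 0))).
rewrite wd in cw.
rewrite /continuous_at -/p; have := cvg_comp _ _ cw cp.
rewrite (_ : _ \o _ = cot_quot) //; apply/funext => u /=; apply: cot_quotD.
apply/quot_eqP => j.
have /quot_eqP/(_ j) : quot (lsubmx w) = quot (chart a p.1) by rewrite chartK.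
move=> /cong_tau_sym/(cong_tauD (cong_tau_refl (lsubmx u 0 j - lsubmx w 0 j))).
rewrite subrK; congr (cong_tau _ _).
by rewrite [RHS]mxE [X in _ = _ + X]mxE [X in _ = _ + (_ + X)]mxE addrA addrAC.
Qed.

Lemma cotangent_torus_hausdorff : hausdorff_space (cotangent T).
Proof.
apply: (@continuous_inj_hausdorff (cotangent T) 'rV[R]_(n + n + n)
  (fun p : cotangent T => row_mx (trig (val p.1)) p.2)).
- apply: charted_continuous => a p ap.
  have pE : p = cot_quot (@chart _ _ (cotangent T) a p).
    by rewrite cot_chartE /cot_quot row_mxKl row_mxKr chartK; case: (p).
  have trigE v : row_mx (trig (val (cot_quot v).1)) (cot_quot v).2 =
      row_mx (trig (lsubmx v)) (rsubmx v) by rewrite trig_val.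
  rewrite [in X in _ --> X]pE trigE.
  have : {for @chart _ _ (cotangent T) a p, continuous
      (fun v : 'rV[R]_(n + n) => row_mx (trig (lsubmx v)) (rsubmx v))}.
    apply: continuous_row_mx; last exact: continuous_rsubmx.
    by apply: continuous_comp; [exact: continuous_lsubmx|exact: continuous_trig].
  apply: near_eq_cvg_at.
  by apply: filterS (cot_param_near ap) => v ->; rewrite trigE.
- move=> p q /eq_row_mx[/trigP pq1 pq2]; rewrite !quot_val in pq1.
  by case: p q pq1 pq2 => ? ? [? ?] /= -> ->.
- exact: norm_hausdorff.
Qed.

Lemma tangent_map_cotangent_proj (p : cotangent T) w :
  tangent_map (@cotangent_proj R n T) p w = lsubmx w.
Proof.
apply: derive_val; set a := chart_at p.1.
have ap : chart_dom a p.1 by exact: chart_at_dom.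
apply: (is_derive_near_affine (l := lsubmx) (b := 0)).
pose P v := chart a (quot v) = v.
have aq : chart_dom a (quot (chart a p.1)) by rewrite chartK.
have nearP : \forall v \near lsubmx (row_mx (chart a p.1) p.2), P v.
  rewrite row_mxKl; apply: filterS (chart_quot_near aq) => v [_].
  by rewrite chartK subrr addr0.
have {}nearP : \forall u \near row_mx (chart a p.1) p.2, P (lsubmx u).
  exact: (@continuous_lsubmx R 1 n n _ P nearP).
by rewrite cot_chartE; apply: filterS nearP => u Pu; rewrite addr0; exact: Pu.
Qed.

Lemma pairing_basis (xi : 'rV[R]_n) :
  \row_j pairing xi (lsubmx (basis_vec R j)) = row_mx xi (0 : 'rV[R]_n).
Proof.
apply/rowP => j; rewrite !mxE.
case: (splitP j) => l jl; rewrite /pairing.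
  have -> : j = lshift n l by exact: val_inj.
  rewrite (bigD1 l) //= big1 ?addr0 => [|m ml]; first by rewrite !mxE !eqxx mulr1.
  by rewrite !mxE eq_lshift (negPf ml) andbF mulr0.
have -> : j = rshift n l by exact: val_inj.
by rewrite big1 ?mxE // => m _; rewrite !mxE eq_lrshift andbF mulr0.
Qed.

Lemma liouville_torus (p : cotangent T) :
  liouville p = row_mx p.2 0.
Proof.
rewrite -pairing_basis; apply/rowP => j.
by rewrite !mxE tangent_map_cotangent_proj.
Qed.

Lemma pullback_cotangent_proj (beta : form1 T) (p : cotangent T) :
  pullback (@cotangent_proj R n T) beta p = row_mx (beta p.1) 0.
Proof.
rewrite -pairing_basis; apply/rowP => j.
by rewrite !mxE tangent_map_cotangent_proj.
Qed.

(** * Maps from a torus to the cotangent bundle, given by a lift to the coverings *)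

Section Lift.
Context (m : nat) (f : torus R m -> cotangent T) (g : 'rV[R]_m -> 'rV[R]_(n + n)).
Hypothesis fg : forall v, f (quot v) = cot_quot (g v).

Lemma lift_chart_near (b : atlas T) v : continuous g ->
  chart_dom b (quot (lsubmx (g v))) ->
  \forall u \near v, @chart _ _ (cotangent T) b (f (quot u)) =
    g u + row_mx (chart b (quot (lsubmx (g v))) - lsubmx (g v)) 0.
Proof.
move=> cg bgv; set d := row_mx _ 0.
pose P w := chart_dom b (quot (lsubmx w)) /\
  @chart _ _ (cotangent T) b (cot_quot w) = w + d.
have near_v : \forall u \near v, P (g u) := cg v P (cot_chart_near bgv).
by apply: filterS near_v => u [_ chartu]; rewrite fg; exact: chartu.
Qed.

Lemma lift_smooth_map : smooth_on_rV setT g -> smooth_map f.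
Proof.
move=> smg; have cg := smooth_continuous smg; split.
  apply: charted_continuous => a x _.
  rewrite -[in X in _ --> X](chartK a x) fg.
  under eq_fun do rewrite paramE fg.
  exact: (continuous_comp (cg _) (@continuous_cot_quot _)).
move=> a; change (atlas (cotangent T)) with (atlas T) => b.
apply: smooth_on_rV_near => _ [x [_ bx] <-].
have bgx : chart_dom b (quot (lsubmx (g (chart a x)))).
  by move: bx; rewrite /= -[in f x](chartK a x) fg.
exists (fun u => g u + row_mx (chart b (quot (lsubmx (g (chart a x)))) -
    lsubmx (g (chart a x))) 0); first exact: smooth_addr.
exact: lift_chart_near.
Qed.

(** In the preferred charts [f] is the lift [g] up to an additive constant, near [val x]. *)
Lemma tangent_map_lift (x : torus R m) w d : continuous g ->
  is_derive (val x) w g d -> tangent_map f x w = d.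
Proof.
move=> cg dg; rewrite /tangent_map chart_at_val; apply: derive_val.
have fx : f x = cot_quot (g (val x)) by rewrite -fg quot_val.
have bx : chart_dom (chart_at (f x).1) (quot (lsubmx (g (val x)))).
  by rewrite fx; exact: chart_at_dom.
set c := row_mx (chart (chart_at (f x).1) (quot (lsubmx (g (val x)))) -
  lsubmx (g (val x))) (0 : 'rV[R]_n).
have dgc : is_derive (val x) w (fun u => g u + c) d.
  by have := is_deriveD dg (is_derive_cst c (val x) w); rewrite addr0.
apply: near_eq_is_derive dgc.
by apply: filterS (lift_chart_near cg bx) => u chartu; exact: esym chartu.
Qed.
End Lift.

Lemma section_smooth_map (beta : 'rV[R]_n) :
  smooth_map (section1 (fun _ : T => beta)).
Proof.
apply: (@lift_smooth_map n _ (fun v => row_mx v beta)).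
  by move=> v; rewrite /cot_quot row_mxKl row_mxKr.
exact: smooth_row_mx (@smooth_id _ _) (@smooth_cst _ _ _ _).
Qed.

Lemma constant_form_closed (beta : 'rV[R]_n) : closed_form1 (fun _ : T => beta).
Proof.
split=> [|a j k v _]; first exact: section_smooth_map.
have coordE l : form1_coord (fun _ : T => beta) a l = fun=> beta 0 l.
  apply/funext => u; rewrite /form1_coord change_covector_torus //.
  exact: chart_at_dom.
by rewrite !coordE !derive_cst.
Qed.

End CotangentTorus.

(** * The example *)

Lemma cube_inj (R : realDomainType) : injective (fun x : R => x ^+ 3).
Proof.
move=> x y /= /eqP; rewrite -subr_eq0.
have -> : x ^+ 3 - y ^+ 3 = (x - y) * (x ^+ 2 + x * y + y ^+ 2) by ring.
rewrite mulf_eq0 subr_eq0 => /orP[/eqP //|/eqP xy0].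
(* Twice the second factor is the sum of these three squares. *)
have := sqr_ge0 (x + y); have := sqr_ge0 x; have := sqr_ge0 y => y2 x2 xy2.
have /eqP : x ^+ 2 = 0 by apply/eqP; rewrite eq_le x2 andbT; nra.
have /eqP : y ^+ 2 = 0 by apply/eqP; rewrite eq_le y2 andbT; nra.
by rewrite !sqrf_eq0 => /eqP -> /eqP ->.
Qed.

Lemma lichnerowiczE (R : realType) n (X : charted R n) (beta : form1 X)
    (f : X -> R) x j :
  lichnerowicz beta f x 0 j = differential f x 0 j - f x * beta x 0 j.
Proof. by rewrite /lichnerowicz mxE [X in _ + X]mxE [X in - X]mxE. Qed.

Section Example.
Context (R : realType).
Local Notation T2 := (torus R 2).

Lemma ord2P (P : 'I_2 -> Prop) : P 0 -> P 1 -> forall j, P j.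
Proof.
by move=> P0 P1 [[|[|//]] jlt];
  [rewrite (_ : Ordinal _ = 0) //|rewrite (_ : Ordinal _ = 1) //]; exact: val_inj.
Qed.

(** In the order (x_0, x_1, p_0, p_1), with t = [v 0 1]. The curve is Legendrian: dp_0 + p_1 dx_1 =
    3 sin^2 t cos t dt - 3 sin^2 t cos t dt = 0. *)
Definition knot (v : 'rV[R]_2) : 'rV[R]_(2 + 2) :=
  row_mx (\row_j if j == 0 then v 0 0 else cos (v 0 1))
    (\row_j if j == 0 then sin (v 0 1) ^+ 3 else 3 * sin (v 0 1) * cos (v 0 1)).

Definition knot_torus (x : T2) : cotangent T2 := cot_quot (knot (val x)).

Definition dknot (v w : 'rV[R]_2) : 'rV[R]_(2 + 2) :=
  row_mx (\row_j if j == 0 then w 0 0 else - sin (v 0 1) * w 0 1)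
    (\row_j if j == 0 then 3 * sin (v 0 1) ^+ 2 * cos (v 0 1) * w 0 1
             else 3 * (cos (v 0 1) ^+ 2 - sin (v 0 1) ^+ 2) * w 0 1).

Definition beta0 : form1 T2 := fun=> basis_vec R 0.

Definition primitive (x : T2) : R := - sin (val x 0 1) ^+ 3.

Lemma knot_torusE v : knot_torus (quot v) = cot_quot (knot v).
Proof.
have [sv cv] := cong_tau_trig (cong_tau_sym (cong_wrap v 1)).
rewrite /knot_torus /cot_quot !row_mxKl !row_mxKr /= sv cv; congr (_, _).
apply/quot_eqP; apply: ord2P; rewrite !mxE /=; last exact: cong_tau_refl.
by apply: cong_tau_sym; exact: cong_mod_tau.
Qed.

Lemma smooth_knot : smooth_on_rV setT knot.
Proof.
apply: smooth_row_mx => + k; apply: ord2P; under eq_fun do rewrite mxE /=.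
- exact: Ck_coord.
- by have [] := Ck_trig R k (1 : 'I_2).
- have [sink cosk] := Ck_trig R k (1 : 'I_2).
  by under eq_fun do rewrite exprS expr2; apply: CkM => //; exact: CkM.
- have [sink cosk] := Ck_trig R k (1 : 'I_2).
  by apply: CkM => //; apply: CkM => //; exact: Ck_cst.
Qed.

Lemma is_derive_knot v w : is_derive v w knot (dknot v w).
Proof.
have d0 := is_derive_coord v w 0.
have ds := is_derive_comp_coord w (is_derive_sin (v 0 1)).
have dc := is_derive_comp_coord w (is_derive_cos (v 0 1)).
apply: is_derive_row_mx; apply: ord2P; under eq_fun do rewrite mxE /=;
  rewrite mxE /=.
- exact: d0.
- by apply: is_derive_eq; rewrite mulrN mulNr mulrC.
- apply: is_derive_eq; rewrite /GRing.scale /=; ring.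
- apply: is_derive_eq; rewrite /GRing.scale /=; ring.
Qed.

Lemma tangent_knot (x : T2) w : tangent_map knot_torus x w = dknot (val x) w.
Proof.
apply: (tangent_map_lift knot_torusE); last exact: is_derive_knot.
exact: smooth_continuous smooth_knot.
Qed.

(** The value of p_0 determines sin t, cubing being injective. The base point gives cos t modulo
    tau, hence exactly, since two cosines differ by at most 2 < tau. *)
Lemma knot_torus_inj : injective knot_torus.
Proof.
move=> x y kxy.
have /quot_eqP : quot (lsubmx (knot (val x))) = quot (lsubmx (knot (val y))) :=
  congr1 fst kxy.
have /rowP : rsubmx (knot (val x)) = rsubmx (knot (val y)) := congr1 snd kxy.
rewrite /knot !row_mxKl !row_mxKr => fib_eq base_eq.
have := base_eq 0; have := base_eq 1; have := fib_eq 0.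
rewrite !mxE /= => sin3 cosxy xy0.
rewrite -(quot_val x) -(quot_val y); apply/quot_eqP; apply: ord2P => //.
apply: trig_cong_tau; first exact: cube_inj.
apply: cong_tau_eq cosxy.
have := pi_ge2 R; have := cos_geN1 (val x 0 1); have := cos_le1 (val x 0 1).
have := cos_geN1 (val y 0 1); have := cos_le1 (val y 0 1).
rewrite /tau ltr_norml => ? ? ? ? ?; apply/andP; split; lra.
Qed.

Lemma knot_torus_embedding : embedding knot_torus.
Proof.
split; [|move=> x v w|exact: knot_torus_inj|].
- exact: lift_smooth_map knot_torusE smooth_knot.
- rewrite !tangent_knot => /eq_row_mx[/rowP dbase /rowP dfib].
  have := dbase 0; have := dbase 1; have := dfib 1; rewrite !mxE /=.
  set t := sval x 0 1 => d1 d2 d3; apply/rowP; apply: ord2P => //.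
  (* Where sin t = 0, the derivative 3 (cos^2 t - sin^2 t) of p_1 is 3; elsewhere the derivative -
     sin t of x_1 is nonzero. *)
  have [s0|s0] := eqVneq (sin t) 0.
    move: d1; rewrite cos2sin2 s0 expr0n /= !subr0 mulr1.
    by apply: mulfI; rewrite pnatr_eq0.
  by apply: (mulfI _ d2); rewrite oppr_eq0.
(* A continuous injection from a compact space to a Hausdorff space is a homeomorphism onto its
   image: the image of the complement of [U] is compact, hence closed. *)
move=> U oU; exists (~` (knot_torus @` ~` U)).
  apply: closed_openC; apply: compact_closed; first exact: cotangent_torus_hausdorff.
  apply: continuous_compact.
    apply: continuous_subspaceT.
    by have [] := lift_smooth_map knot_torusE smooth_knot.
  apply: (@subclosed_compact _ (~` U) setT) => //; first exact: open_closedC.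
  exact: torus_compact.
apply/seteqP; split=> x /=.
  by move=> Ux [y Uy /knot_torus_inj yx]; rewrite yx in Uy.
by move=> nx; apply: contrapT => Ux; apply: nx; exists x.
Qed.

(** With t = [v 0 1], both sides are sin^3 t dv_0 - 3 sin^2 t cos t dt: the first term is - f beta
    and the second is df, for f = - sin^3 t. *)
Lemma knot_torus_exact : exact_lagrangian beta0 knot_torus.
Proof.
split; first exact: knot_torus_embedding.
have primE a : primitive \o @param _ _ T2 a = fun v => - sin (v 0 1) ^+ 3.
  apply/funext => v; rewrite /primitive /=.
  by have [-> _] := cong_tau_trig (cong_tau_sym (cong_wrap v 1)).
exists primitive.
  move=> a k; rewrite primE; apply: Ck_near => v _.
  exists (fun v => (-1) * (sin (v 0 1) * (sin (v 0 1) * sin (v 0 1)))).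
    have [sink _] := Ck_trig R k (1 : 'I_2).
    by apply: CkM; [exact: Ck_cst|apply: CkM => //; exact: CkM].
  by apply: (@filterE _ (nbhs v)) => u; rewrite mulN1r exprS expr2.
apply/funext => x; apply/rowP => j.
have ds := is_derive_comp_coord (basis_vec R j) (is_derive_sin (val x 0 1)).
have df : is_derive (val x) (basis_vec R j) (fun v => - sin (v 0 1) ^+ 3)
    (- (3 * sin (val x 0 1) ^+ 2 * (cos (val x 0 1) * basis_vec R j 0 1))).
  by apply: is_derive_eq; rewrite /GRing.scale /=; ring.
rewrite lichnerowiczE [X in _ = X - _]mxE primE chart_at_val.
rewrite (@derive_val _ _ _ _ _ _ _ df) !mxE liouville_torus tangent_knot.
rewrite pullback_cotangent_proj /pairing !big_split_ord /= !big_ord_recl !big_ord0.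
rewrite !row_mxEl !row_mxEr /= /knot row_mxKr !mxE /= /primitive; ring.
Qed.

End Example.

Theorem theorem1p1 (R : realType) :
  exists (n : nat) (M L : charted R n) (beta : form1 M) (i : L -> cotangent M),
    [/\ n <> 3%N,
        connected_closed_manifold M /\ connected_closed_manifold L,
        closed_form1 beta,
        exact_lagrangian beta i &
        euler_char R L <> euler_char R M \/
        ~ (exists (k : nat) (F : prod_charted M (euclid R k) -> R),
             generating_function beta F /\
             range i = generated_lagrangian beta F)].
Proof.
exists 2%N, (torus R 2), (torus R 2), (@beta0 R), (@knot_torus R).
split.
- by [].
- by split; exact: torus_closed_manifold.
- exact: constant_form_closed.
- exact: knot_torus_exact.
right=> -[k [F [genF rangeE]]].
(* L_F has a point over x_1 = pi, whereas on the knot x_1 = cos t lies in [-1, 1]. *)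
have [q] := generated_lagrangian_onto (torus_manifold R 2) (quot (const_mx pi)) genF.
rewrite -rangeE => -[x _ <-] /quot_eqP/(_ 1).
rewrite /knot row_mxKl !mxE /= => cos_pi.
have := cos_geN1 (val x 0 1); have := cos_le1 (val x 0 1).
have := pi_ge2 R => pi2 cle cge.
(* The congruence is an equality because |cos t - pi| <= 1 + pi < tau. *)
have eq_pi : cos (val x 0 1) = pi.
  by apply: cong_tau_eq cos_pi; rewrite /tau ltr_norml; apply/andP; split; lra.
by move: cle; rewrite eq_pi leNgt (lt_le_trans _ pi2) // ltr1n.
Qed.
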